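(* Let $\mathcal{X}$ be a Polish space and let $\mu$ be a $\sigma$-finite measure over $\mathcal{X}$ with $|\mathrm{supp}(\mu)|\ge 2$, where $|\mathrm{supp}(\mu)|\in\mathbb{N}\cup\{\infty\}$ is the cardinality of the support of $\mu$. Let $\mathbf{1}_{\neq}(x,y):=\mathbf{1}\{x\neq y\}$ be the discrete metric cost. Then \[ 2\left(1-\frac{1}{|\mathrm{supp}(\mu)|}\right)\le r_{\mathbf{1}_{\neq}}^{*}(\mathcal{P}_{\ll\mu}(\mathcal{X}))\le\min\left\{2,\,\frac{|\mathrm{supp}(\mu)|+1}{3}\right\}. \] Moreover, there exists a coupling $\{X_{\alpha}\}_{\alpha}$ of the collection $\mathcal{P}_{\ll\mu}(\mathcal{X})$ such that $r_{\mathbf{1}_{\neq}}(\{X_{\alpha}\}_{\alpha})\le\min\{2,\,(|\mathrm{supp}(\mu)|+1)/3\}$. In particular, when $|\mathrm{supp}(\mu)|=\infty$, we have $r_{\mathbf{1}_{\neq}}^{*}(\mathcal{P}_{\ll\mu}(\mathcal{X}))=2$.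
   Context: Polish spaces carry their Borel $\sigma$-algebras. A symmetric cost function over a Polish space $\mathcal{X}$ is a function $c:\mathcal{X}^2\to[0,\infty)$ that is measurable with respect to the product $\sigma$-algebra, symmetric, not identically zero, and satisfies $c(x,x)=0$ for all $x$. $\mathcal{P}(\mathcal{X})$ is the set of all probability distributions over $\mathcal{X}$, and $\mathcal{P}_{\ll\mu}(\mathcal{X}):=\{P\in\mathcal{P}(\mathcal{X}): P\ll\mu\}$. The support is $\mathrm{supp}(\mu):=\{x\in\mathcal{X}:\mu(S)>0\text{ for every open set }S\ni x\}$; when it is infinite write $|\mathrm{supp}(\mu)|=\infty$ and $1/\infty=0$. A coupling of a collection $\{P_\alpha\}_{\alpha\in\mathcal{A}}$ of probability distributions over $\mathcal{X}$ ($\mathcal{A}$ an arbitrary index set) is a family of random variables $X_\alpha:[0,1]\to\mathcal{X}$, all defined on the standard probability space ($[0,1]$, Lebesgue measurable sets, Lebesgue measure), with $X_\alpha\sim P_\alpha$ for every $\alpha$. For $P,Q\in\mathcal{P}(\mathcal{X})$, $C_c^*(P,Q):=\inf\mathbf{E}[c(X,Y)]$ over couplings $(X,Y)$ of $(P,Q)$ (for $c=\mathbf{1}_{\neq}$ this is the total variation distance). The pairwise coupling ratio of a coupling is $r_c(\{X_\alpha\}_{\alpha}):=\inf\{r\ge1:\mathbf{E}[c(X_\alpha,X_\beta)]\le r\,C_c^*(P_\alpha,P_\beta)\ \forall\alpha,\beta\in\mathcal{A}\}$ ($\infty$ if no such $r$ exists), and $r_c^*(\{P_\alpha\}_{\alpha}):=\inf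 r_c(\{X_\alpha\}_\alpha)$ over all couplings of $\{P_\alpha\}_\alpha$. A set of probability distributions is regarded as a collection indexed by itself. *)

(* Defs.v *)
From HB Require Import structures.
From mathcomp Require Import all_boot all_order all_algebra.
From mathcomp Require Import all_classical all_reals all_analysis.

Set Implicit Arguments.
Unset Strict Implicit.
Unset Printing Implicit Defensive.

Import Order.TTheory GRing.Theory Num.Theory.
Import numFieldNormedType.Exports.

Local Open Scope classical_set_scope.
Local Open Scope ring_scope.

Definition metric_on (R : realType) (X : Type) (d : X -> X -> R) : Prop :=
  [/\ forall x y, d x y = 0 <-> x = y,
      forall x y, d x y = d y x
    & forall x y z, d x z <= d x y + d y z].

Definition induces_topology (R : realType) (X : topologicalType)
    (d : X -> X -> R) : Prop :=
  forall (x : X) (A : set X),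
    nbhs x A <-> exists2 e : R, 0 < e & [set y | d x y < e] `<=` A.

Definition complete_metric (R : realType) (X : topologicalType)
    (d : X -> X -> R) : Prop :=
  forall u : nat -> X,
    (forall e : R, 0 < e -> exists N : nat, forall m n : nat,
       (N <= m)%N -> (N <= n)%N -> d (u m) (u n) < e) ->
    exists l : X, u @ \oo --> l.

Definition separable (X : topologicalType) : Prop :=
  exists2 D : set X, countable D & dense D.

Definition polish_space (R : realType) (X : topologicalType) : Prop :=
  separable X /\
  exists d : X -> X -> R,
    [/\ metric_on d, induces_topology d & complete_metric d].

Definition borel (X : ptopologicalType) := g_sigma_algebraType (@open X).
HB.instance Definition _ (X : ptopologicalType) :=
  Measurable.on (borel X).

Definition unit_interval (R : realType) : Type :=
  set_type (`[0, 1]%classic : set R).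

Section unit_interval.
Context (R : realType).

HB.instance Definition _ := gen_eqMixin (unit_interval R).
HB.instance Definition _ := gen_choiceMixin (unit_interval R).

Definition unit_val (t : unit_interval R) : R := set_val t.

Lemma unit_val_inj : injective unit_val.
Proof. by move=> s t; rewrite /unit_val !set_valE => /val_inj. Qed.

Lemma unit_val_itv (t : unit_interval R) : `[0, 1]%classic (unit_val t).
Proof. by rewrite /unit_val set_valE; exact: set_valP. Qed.

Lemma unit_val_range : range unit_val = `[0, 1]%classic.
Proof.
apply/seteqP; split=> [_ [t _ <-]|x x01]; first exact: unit_val_itv.
by exists (SigSub (mem_set x01)) => //; rewrite /unit_val set_valE.
Qed.

Lemma zero_in_unit_interval : `[0, 1]%classic (0 : R).
Proof. by rewrite /= in_itv /= lexx ler01. Qed.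

HB.instance Definition _ :=
  isPointed.Build (unit_interval R) (SigSub (mem_set zero_in_unit_interval)).

(* [completed_lebesgue_measure] lives on the Caratheodory sigma-algebra of the
   outer Lebesgue measure, i.e. on the Lebesgue measurable subsets of R. *)
Definition lebesgue_measurable : set (set R) :=
  @measurable _ (caratheodory_type (@wlength R idfun)^*%mu).

Definition unit_measurable : set (set (unit_interval R)) :=
  [set A | lebesgue_measurable (unit_val @` A)].

Let lebesgue_measurable_itv : lebesgue_measurable `[0, 1]%classic.
Proof.
apply: sub_caratheodory.
have : measurable (`[0, 1]%classic : set (measurableTypeR R)).
  exact: measurable_itv.
by [].
Qed.

Let unit_measurable0 : unit_measurable set0.
Proof. by rewrite /unit_measurable/= image_set0; exact: measurable0. Qed.

Let unit_measurableC A : unit_measurable A -> unit_measurable (~` A).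
Proof.
rewrite /unit_measurable/= /lebesgue_measurable => mA.
have -> : unit_val @` (~` A) = `[0, 1]%classic `\` unit_val @` A.
  rewrite -unit_val_range; apply/seteqP; split.
    move=> _ [t At <-]; split; first by exists t.
    by move=> [s As /unit_val_inj st]; apply: At; rewrite -st.
  by move=> _ [[t _ <-] nA]; exists t => // At; apply: nA; exists t.
apply: measurableD mA; exact: lebesgue_measurable_itv.
Qed.

Let unit_measurable_bigcup (F : (set (unit_interval R))^nat) :
  (forall i, unit_measurable (F i)) -> unit_measurable (\bigcup_i F i).
Proof.
rewrite /unit_measurable/= image_bigcup /lebesgue_measurable => mF.
exact: bigcup_measurable.
Qed.

HB.instance Definition _ := @isMeasurable.Build default_measure_display
  (unit_interval R) unit_measurable
  unit_measurable0 unit_measurableC unit_measurable_bigcup.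

Definition lebesgue01 (A : set (unit_interval R)) : \bar R :=
  completed_lebesgue_measure (unit_val @` A).

Let lebesgue01_0 : lebesgue01 set0 = 0%E.
Proof. by rewrite /lebesgue01 image_set0 measure0. Qed.

Let lebesgue01_ge0 A : (0 <= lebesgue01 A)%E.
Proof. exact: measure_ge0. Qed.

Let lebesgue01_sigma_additive : semi_sigma_additive lebesgue01.
Proof.
move=> F mF tF mUF; rewrite /lebesgue01 image_bigcup.
apply: measure_semi_sigma_additive => //.
- apply/trivIsetP => i j _ _ ij; rewrite -subset0 => x [[s Fs <-] [t Ft]].
  move=> /unit_val_inj ts; move/trivIsetP : tF => /(_ i j I I ij).
  by rewrite -subset0; apply; split; [exact: Fs|rewrite -ts].
- by apply: bigcup_measurable => k _; exact: mF.
Qed.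

HB.instance Definition _ := isMeasure.Build _ _ _ lebesgue01
  lebesgue01_0 lebesgue01_ge0 lebesgue01_sigma_additive.

Let lebesgue01_setT : lebesgue01 setT = 1%E.
Proof.
rewrite /lebesgue01 unit_val_range.
have -> : completed_lebesgue_measure `[0, 1]%classic =
    lebesgue_measure (`[0, 1]%classic : set (measurableTypeR R)) by [].
by rewrite lebesgue_measure_itv/= lte_fin ltr01 sube0.
Qed.

HB.instance Definition _ :=
  Measure_isProbability.Build _ _ _ lebesgue01 lebesgue01_setT.

End unit_interval.

Definition measure_support (R : realType) (X : ptopologicalType)
    (mu : set (borel X) -> \bar R) : set X :=
  [set x | forall S : set X, open S -> S x -> (0 < mu S)%E].

(* Two terms of type [probability (borel X) R] that agree on every Borel set
   but differ as functions on non-measurable sets are distinct members of this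
   set.  All the notions below only see Borel sets, and such a pair has transport
   cost 0, so repeating a distribution does not change the optimal ratio. *)
Definition ac_probabilities (R : realType) (X : ptopologicalType)
    (mu : {measure set (borel X) -> \bar R}) :
    set (probability (borel X) R) :=
  [set P | P `<< mu].

Definition discrete_cost (R : realType) (X : ptopologicalType) (x y : X) : R :=
  (x != y)%:R.

Section coupling.
Context (R : realType) (X : ptopologicalType).
Local Notation law := (probability (borel X) R).
Local Notation random_element := {RV (@lebesgue01 R) >-> borel X}.
Local Open Scope ereal_scope.
Implicit Types (c : X -> X -> R) (P Q : law) (Y Z : random_element).

Definition has_law Y P : Prop :=
  forall A : set (borel X), measurable A -> distribution (@lebesgue01 R) Y A = P A.

Definition expected_cost c Y Z : \bar R :=
  'E_(@lebesgue01 R)[fun t => c (Y t) (Z t)].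

Definition transport_cost c P Q : \bar R :=
  ereal_inf [set e | exists Y Z,
    [/\ has_law Y P, has_law Z Q & e = expected_cost c Y Z]].

Definition is_coupling (I : Type) (P : I -> law) (Y : I -> random_element) :
    Prop :=
  forall i, has_law (Y i) (P i).

(* The infimum of the empty set is +oo. *)
Definition coupling_ratio c (I : Type) (P : I -> law)
    (Y : I -> random_element) : \bar R :=
  ereal_inf [set r%:E | r in [set r : R | (1 <= r)%R /\
    forall i j,
      expected_cost c (Y i) (Y j) <= r%:E * transport_cost c (P i) (P j)]].

Definition optimal_ratio c (I : Type) (P : I -> law) : \bar R :=
  ereal_inf [set coupling_ratio c P Y | Y in [set Y | is_coupling P Y]].

Definition self_indexed (S : set law) (P : S) : law := set_val P.

End coupling.
Arguments self_indexed {R X} S P.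

(* Main.v *)
Require Import Defs.
From HB Require Import structures.
From mathcomp Require Import all_boot all_order all_fingroup all_algebra.
From mathcomp Require Import all_classical all_reals all_analysis.
From mathcomp Require Import measurable_realfun.
From mathcomp Require Import ring lra.

Set Implicit Arguments.
Unset Strict Implicit.
Unset Printing Implicit Defensive.
Import Order.TTheory GRing.Theory Num.Theory.
Import numFieldNormedType.Exports.
Local Open Scope classical_set_scope.
Local Open Scope ring_scope.

(** Three constructions give the theorem, all of them driven by a single
    uniform variable on the unit interval.

    The bound 2 comes from a Poisson process.  Let [nu] be a probability with
    the null sets of [mu], and let points of [X * [0, oo)] arrive in time with
    intensity [nu] times Lebesgue measure.  Let [K P] be the region under the
    density of [P], which has mass 1, and let [X_P] be the [X]-coordinate of the
    earliest point in [K P].  Its law is [P].  The variables [X_P] and [X_Q] can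
    only differ when the earliest point of the union of [K P] and [K Q] is in
    their symmetric difference; if the total variation distance is [t] this has
    probability [2 t / (1 + t)], which is at most [2 t].  Time is cut in
    independent rounds of length one, and the half line in strips of height one,
    so that every strip has Poisson(1) many points per round
    ([round_void_law], [race_bound], [sel_diff_le], [poisson_coupling]).

    For a support of [n] points the bound [(n + 1) / 3] comes from listing the
    support in a uniformly random order and taking the quantile coupling of all
    laws along that order.  Given the order, the variables of two laws
    disagree with probability at most the cost of moving one law to the other
    when the points have the integer positions [0, ..., n - 1].  Two distinct points are on average
    [(n + 1) / 3] apart in a random order, so the average is at most
    [(n + 1) / 3] times the cost of any coupling of the two laws
    ([perm_dist], [step_diff], [qcoupling_diff]).

    For the lower bound take [m] points of the support, disjoint open sets
    [O k] around them and the conditional laws [Q k] of [nu] on [O k].  Let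
    [P j] be the average of the [Q k] over [k != j].  Exchanging [Q k] for [Q j]
    shows that [P j] and [P k] are at distance at most [1 / (m - 1)].  Since
    [P j] does not charge [O j], variables with the laws [P j] are almost
    surely not all equal, so at least [m - 1] of their pairs disagree.  Averaging over the pairs
    gives [2 (1 - 1 / m)], for every [m] if the support is infinite
    ([lower_bound]).

    All of this is measurable because a Polish space is a Borel retract of the
    line ([metric_retract]): every law is then the image of the uniform law
    ([realize]), the event that two variables differ is measurable, and one
    uniform variable contains infinitely many independent ones
    ([split_uniform]). *)

(** * Laws on the line as images of the uniform law *)

Section probability_facts.
Context d (T : measurableType d) (R : realType) (P : probability T R).

Lemma probability_setI1 A B : measurable A -> measurable B -> P B = 1%E ->
  P (A `&` B) = P A.
Proof.
move=> mA mB PB; have -> : P A = (P (A `\` B) + P (A `&` B))%E by exact: measureDI.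
suff -> : P (A `\` B) = 0%E by rewrite add0e.
apply/eqP; rewrite eq_le measure_ge0 andbT.
have <- : P (~` B) = 0%E by rewrite probability_setC// PB subee.
apply: le_measure; rewrite ?inE; [exact: measurableD|exact: measurableC|].
by move=> x [].
Qed.

End probability_facts.

Definition mfun_of d d' (T : measurableType d) (T' : measurableType d')
    (f : T -> T') (mf : measurable_fun setT f) : {mfun T >-> T'} :=
  HB.pack_for {mfun T >-> T'} f (isMeasurableFun.Build _ _ _ _ f mf).

Lemma measurable_preimage d d' (T : measurableType d) (T' : measurableType d')
    (f : T -> T') (A : set T') :
  measurable_fun setT f -> measurable A -> measurable (f @^-1` A).
Proof. by move=> mf mA; rewrite -[X in measurable X]setTI; exact: mf. Qed.

Section uniform_source.
Context (R : realType).
Local Notation TR := (measurableTypeR R).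

(** The unit interval has the Lebesgue measurable sets, the line the Borel sets;
    composing with [unit_val] makes a Borel function on the line a random
    variable. *)
Lemma measurable_unit_val :
  measurable_fun setT (@unit_val R : unit_interval R -> TR).
Proof.
move=> _ A mA; rewrite setTI.
suff : lebesgue_measurable (@unit_val R @` (@unit_val R @^-1` A)) by [].
have -> : @unit_val R @` (@unit_val R @^-1` A) = A `&` `[0, 1]%classic.
  apply/seteqP; split=> [_ [t At <-]|x [Ax]]; first by split=> //; exact: unit_val_itv.
  by rewrite -unit_val_range => -[t _ tx]; exists t => //=; rewrite tx.
apply: sub_caratheodory.
have : measurable (A `&` `[0, 1]%classic : set TR).
  by apply: measurableI => //; exact: measurable_itv.
by [].
Qed.

HB.instance Definition _ := isMeasurableFun.Build _ _ _ _
  (@unit_val R : unit_interval R -> TR) measurable_unit_val.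

Definition unif : probability TR R :=
  distribution (@lebesgue01 R) (@unit_val R : {RV (@lebesgue01 R) >-> TR}).

Lemma unifE A : measurable A -> unif A = lebesgue_measure (A `&` `[0, 1]%classic).
Proof.
move=> mA; rewrite /unif /= /distribution /pushforward.
rewrite /lebesgue01 /=.
have -> : @unit_val R @` (@unit_val R @^-1` A) = A `&` `[0, 1]%classic.
  apply/seteqP; split=> [_ [t At <-]|x [Ax]]; first by split=> //; exact: unit_val_itv.
  by rewrite -unit_val_range => -[t _ tx]; exists t => //=; rewrite tx.
by [].
Qed.

Lemma unif_itv (a b : R) (ab : bool) (bb : bool): (0 <= a)%R -> (a <= b)%R -> (b <= 1)%R ->
  unif [set` Interval (BSide ab a) (BSide bb b)] = (b - a)%:E.
Proof.
move=> a0 leab b1; rewrite unifE; last exact: measurable_itv.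
rewrite setIidl; last first.
  move=> x /=; rewrite !itv_boundlr => /andP[ax xb].
  apply/andP; split; [move: ax; case: (ab)|move: xb; case: (bb)]; rewrite !bnd_simp => h.
  - exact: le_trans h.
  - exact: le_trans a0 (ltW h).
  - exact: le_trans (ltW h) b1.
  - exact: le_trans h _.
rewrite lebesgue_measure_itv /= lte_fin.
by case: ltgtP leab => // -> _; rewrite subrr.
Qed.

End uniform_source.

(** All that is used of the uniform law on the unit interval; the booleans make
    each end of the interval open or closed. *)
Definition uniform_law (R : realType) (U : probability (measurableTypeR R) R) :=
  forall (a b : R) (c e : bool), 0 <= a -> a <= b -> b <= 1 ->
    U [set` Interval (BSide c a) (BSide e b)] = (b - a)%:E.

Section quantile.
Context (R : realType).
Local Notation TR := (measurableTypeR R).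
Variable U : probability TR R.
Hypothesis hU : uniform_law U.

Lemma uniform01 c e : U [set` Interval (BSide c 0) (BSide e 1)] = 1%E.
Proof. by rewrite hU// subr0. Qed.

Lemma uniform_le (x : R) : (0 <= x <= 1)%R -> U `]-oo, x]%classic = x%:E.
Proof.
move=> /andP[x0 x1]; rewrite -(probability_setI1 _ _ (uniform01 true false))//.
rewrite -[x in RHS]subr0 -(@hU 0 x true false) //.
congr (U _); apply/seteqP; split=> y /=; rewrite !in_itv /=.
  by move=> [-> /andP[-> _]].
by move=> /andP[y0 yx]; split => //; rewrite y0 (le_trans yx).
Qed.

Let cdfR (k : probability TR R) (x : R) : R := fine (k `]-oo, x]%classic).

Lemma cdfRE (k : probability TR R) x : k `]-oo, x]%classic = (cdfR k x)%:E.
Proof. by rewrite fineK// fin_num_measure. Qed.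

Lemma cdfR_cdf (k : probability TR R) :
  [/\ right_continuous (cdfR k), cdfR k @ +oo --> (1 : R), cdfR k @ -oo --> (0 : R)
    & {homo cdfR k : x y / x <= y}].
Proof.
pose idR : TR -> R := idfun.
have mid : measurable_fun setT idR by exact: measurable_id.
pose idM := mfun_of mid.
have E x : cdf (idM : {RV k >-> R}) x = (cdfR k x)%:E.
  by rewrite -cdfRE.
split.
- move=> x; apply: fine_cvg; rewrite -cdfRE.
  exact: (@cdf_right_continuous _ _ _ k (idM : {RV k >-> R})).
- exact/fine_cvg/(@cvg_cdfy1 _ _ _ k (idM : {RV k >-> R})).
- exact/fine_cvg/(@cvg_cdfNy0 _ _ _ k (idM : {RV k >-> R})).
- by move=> x y xy; rewrite -lee_fin -!E; exact: cdf_nondecreasing.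
Qed.

(** Inverse transform sampling: for [0 < u < 1] the generalized inverse [q] of
    the distribution function [F] satisfies [q u <= x] iff [u <= F x], because
    [F] is right continuous. *)
Lemma quantile (k : probability TR R) :
  exists q : TR -> TR, measurable_fun setT q /\
    forall A, measurable A -> U (q @^-1` A) = k A.
Proof.
have [rc F1 F0 Fmono] := cdfR_cdf k.
pose F := cdfR k.
pose S u := [set x | u <= F x].
pose q (u : TR) : TR := if (0 < u < 1)%R then inf (S u) else 0.
have qP u x : (0 < u < 1)%R -> (q u <= x)%R = (u <= F x)%R.
  move=> u01; rewrite /q u01; move/andP: u01 => [u0 u1].
  have lb : has_lbound (S u).
    have [y [_ Fy]] : \forall y \near -oo, F y < u by exact: (cvgr_lt 0).
    by exists y => z /= uz; rewrite leNgt; apply/negP => /Fy; rewrite ltNge uz.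
  have ne : S u !=set0.
    have [y [_ Fy]] : \forall y \near +oo, u < F y by exact: (cvgr_gt 1).
    by exists (y + 1) => /=; apply/ltW/Fy; rewrite ltrDl.
  apply/idP/idP => [qx|ux]; last by apply: ge_inf.
  apply: (@cvgr_to_ge _ _ _ _ F (F x) u (rc x)).
  near=> y.
  have xy : inf (S u) < y by apply: le_lt_trans qx _; near: y; exact: nbhs_right_gt.
  have [z Sz zy] := inf_lt ne xy.
  by apply: le_trans Sz _; apply: Fmono; exact: ltW.
have qpre x : q @^-1` `]-oo, x]%classic `&` `]0, 1[%classic =
              `]-oo, F x]%classic `&` `]0, 1[%classic.
  apply/seteqP; split=> u /=; rewrite !in_itv /= => -[h u01].
    by rewrite -qP.
  by rewrite qP.
have qpreN x : q @^-1` `]x, +oo[%classic =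
    (`]F x, +oo[%classic `&` `]0, 1[%classic) `|`
    (~` `]0, 1[%classic `&` [set _ | x < 0]).
  apply/seteqP; split=> u /=; rewrite !in_itv /= !andbT.
    have [u01|/negP u01] := boolP (0 < u < 1)%R; last first.
      by rewrite /q ifN //; [right|apply/negP].
    by rewrite ltNge qP// -ltNge => ?; left.
  move=> [[h u01]|[/negP u01 x0]]; first by rewrite ltNge qP// -ltNge.
  by rewrite /q ifN.
have mq : measurable_fun (setT : set TR) q.
  apply: (measurability _ (RGenOInfty.measurableE R)) => _ [_ [x ->] <-].
  rewrite setTI qpreN; apply: measurableU; apply: measurableI => //.
    exact: measurableC.
  by case: (x < 0)%R; [rewrite set_true|rewrite set_false].
exists q; split => //.
move=> A mA.
rewrite -[LHS]/(distribution U (mfun_of mq) A).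
refine (@measure_unique _ _ TR (@RGenOInfty.G R) (fun n => `](- n%:R)%R, +oo[%classic)
  (RGenOInfty.measurableE R) _ _ _ (distribution U (mfun_of mq)) k _ _ A mA) => //.
- move=> _ _ [x ->] [y ->]; exists (Num.max x y).
  by apply/seteqP; split=> z /=; rewrite !in_itv/= !andbT gt_max; [move=> [-> ->]|move=> /andP[]].
- by move=> n; exists (- n%:R).
- rewrite -subTset => x _; exists (Num.truncn `|x|).+1 => //=.
  rewrite in_itv /= andbT ltrNl (le_lt_trans (ler_norm _))//.
  by rewrite normrN; exact: truncnS_gt.
- move=> _ [x ->].
  rewrite -[LHS]/(U (q @^-1` `]x, +oo[%classic)) -[RHS]/(k `]x, +oo[%classic).
  have -> : `]x, +oo[%classic = ~` `]-oo, x]%classic by rewrite setCitvl.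
  have mqx : measurable (q @^-1` `]-oo, x]%classic) by exact: (measurable_preimage mq).
  have mx : measurable (`]-oo, x]%classic : set TR) by exact: measurable_itv.
  rewrite preimage_setC (probability_setC U mqx) (probability_setC k mx).
  rewrite cdfRE -/(F x); congr (1 - _)%E.
  have m01 : U `]0, 1[%classic = 1%E by rewrite uniform01.
  rewrite -(probability_setI1 _ _ m01)//.
  rewrite qpre probability_setI1// uniform_le//.
  by rewrite fine_ge0//= -lee_fin fineK ?fin_num_measure// probability_le1.
- by move=> n; apply: le_lt_trans (probability_le1 _ _) (ltry 1).
Unshelve. all: by end_near. Qed.

End quantile.

(** * Digit expansions, and sampling on retracts of the line *)

Section realization.
Context (R : realType).
Local Notation TR := (measurableTypeR R).

Lemma measurable_idTR : measurable_fun setT (fun x : TR => x : R).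
Proof. exact: measurable_id. Qed.

(** The digits are 0 and 1 in either base.  Base 3 is used to store them, since
    the value then determines the digits; base 2 to expand a real number. *)
Definition bitsum (r : R) (b : nat -> bool) : R :=
  limn (series (fun m => r ^+ m * (b m)%:R)).

Section bitsum.
Variable r : R.
Hypothesis r01 : 0 <= r < 1.

Lemma bitsum_cvg (b : nat -> bool) : cvgn (series (fun m => r ^+ m * (b m)%:R)).
Proof.
have [r0 r1] := andP r01.
apply: (@series_le_cvg _ _ (fun m => 1 * r ^+ m)).
- by move=> n; rewrite mulr_ge0// exprn_ge0.
- by move=> n; rewrite mul1r exprn_ge0.
- by move=> n; rewrite mul1r; case: (b n); rewrite ?mulr1 ?mulr0 ?lexx ?exprn_ge0.
- by apply: is_cvg_geometric_series; rewrite ger0_norm.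
Qed.

Lemma bitsumS (b : nat -> bool) : bitsum r b = (b 0%N)%:R + r * bitsum r (b \o succn).
Proof.
apply/cvg_lim => //; rewrite -(cvg_shiftS _).
have -> : (fun n => series (fun m => r ^+ m * (b m)%:R) n.+1) =
   (fun n => (b 0%N)%:R + r * series (fun m => r ^+ m * (b m.+1)%:R) n).
  apply/funext => n; rewrite /series /= big_nat_recl// expr0 mul1r mulr_sumr.
  by congr (_ + _); apply: eq_bigr => m _; rewrite exprS mulrA.
apply: cvgD; first exact: cvg_cst.
apply: cvgMr; exact: bitsum_cvg.
Qed.

Lemma bitsum_ge0 (b : nat -> bool) : 0 <= bitsum r b.
Proof.
apply: limr_ge; first exact: bitsum_cvg.
have [r0 _] := andP r01.
by apply: nearW => n; rewrite sumr_ge0// => m _; rewrite mulr_ge0// exprn_ge0.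
Qed.

Lemma bitsum_le (b : nat -> bool) : bitsum r b <= (1 - r)^-1.
Proof.
have [r0 r1] := andP r01.
have r1' : 0 < 1 - r by rewrite subr_gt0.
apply: limr_le; first exact: bitsum_cvg.
apply: nearW => n; apply: (@le_trans _ _ (\sum_(0 <= m < n) r ^+ m)).
  by apply: ler_sum => m _; case: (b m); rewrite ?mulr1 ?mulr0 ?lexx ?exprn_ge0.
rewrite -(ler_pM2l r1') mulfV ?gt_eqF// mulrC big_mkord.
rewrite -[X in X <= _]opprK -mulrN opprB mulrC -subrX1.
by rewrite opprB lerBlDr lerDl exprn_ge0.
Qed.

Lemma measurable_bitsum d (T : measurableType d) (b : T -> nat -> bool) :
  (forall m, measurable_fun setT (b ^~ m)) ->
  measurable_fun setT (fun x => bitsum r (b x)).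
Proof.
move=> mb; apply: (@measurable_fun_cvg _ _ _ _
  (fun n x => series (fun m => r ^+ m * (b x m)%:R) n)); last first.
  by move=> x _; exact: bitsum_cvg.
move=> n; apply: measurable_sum => m.
apply: measurable_funM => //.
have -> : (fun x => (b x m)%:R) = (fun x => if b x m then (1:R) else 0).
  by apply/funext => x; case: (b x m).
apply: measurable_fun_ifT => //.
Qed.

End bitsum.

(** The leading ternary digit is 1 iff the value is at least 1, as the other
    digits contribute at most 1/2.  The binary value carries a factor 1/2, so that
    it lies in the unit interval. *)
Definition rest3 (y : R) : R := 3 * (y - (1 <= y)%R%:R).
Definition digit3 (m : nat) (y : R) : bool := 1 <= iter m rest3 y.
Definition rest2 (y : R) : R := 2 * y - (1 <= 2 * y)%R%:R.
Definition digit2 (m : nat) (y : R) : bool := 1 <= 2 * iter m rest2 y.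

Lemma digit3_bitsum (b : nat -> bool) m : digit3 m (bitsum 3^-1 b) = b m.
Proof.
have r01 : 0 <= (3^-1 : R) < 1 by lra.
have bs b' : (1 <= bitsum 3^-1 b') = b' 0%N.
  rewrite bitsumS//; have := bitsum_ge0 r01 (b' \o succn).
  have : bitsum 3^-1 (b' \o succn) <= 3 / 2.
    by rewrite (le_trans (bitsum_le r01 _))// le_eqVlt; apply/orP; left; apply/eqP; field.
  set z := bitsum _ _; case: (b' 0%N); rewrite ?mulr0n ?mulr1n => h1 h2; first by apply/idP; lra.
  by apply/negbTE; rewrite -ltNge; lra.
rewrite /digit3.
suff -> : iter m rest3 (bitsum 3^-1 b) = bitsum 3^-1 (b \o addn m).
  by rewrite bs/= addn0.
elim: m => [|m IH]; first by congr bitsum; apply/funext.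
rewrite iterS IH /rest3 bs bitsumS//=.
have -> : (b \o addn m) \o succn = b \o addn m.+1.
  by apply/funext => n/=; rewrite addnS.
by lra.
Qed.

Lemma bitsum_digit2 x : 0 <= x < 1 -> 2^-1 * bitsum 2^-1 (digit2 ^~ x) = x.
Proof.
move=> x01; have r01 : 0 <= (2^-1 : R) < 1 by lra.
have it n : 0 <= iter n rest2 x < 1.
  by elim: n => [//|n IH]; rewrite iterS /rest2; case: (boolP (1 <= 2 * iter n rest2 x)) => h /=; lra.
have E n : series (fun m => 2^-1 ^+ m * (digit2 m x)%:R) n = 2 * (x - 2^-1 ^+ n * iter n rest2 x).
  rewrite /series/=; elim: n => [|n IH]; first by rewrite big_nil expr0 mul1r subrr mulr0.
  rewrite big_nat_recr//= IH exprS /rest2 -/(digit2 n x).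
  set u := iter n rest2 x; set w := 2^-1 ^+ n; lra.
suff -> : bitsum 2^-1 (digit2 ^~ x) = 2 * x by lra.
apply/cvg_lim => //.
rewrite (funext E).
rewrite -[X in _ --> X](subr0) -[in X in _ --> X](mulr0 2) -mulrBr.
apply: cvgMr; apply: cvgB; first exact: cvg_cst.
apply: (@squeeze_cvgr _ _ _ _ (fun=> 0) (fun n => 2^-1 ^+ n)).
- apply: nearW => n; have := it n; have : 0 <= (2^-1 : R) ^+ n by rewrite exprn_ge0.
  by move=> h /andP[h1 h2]; rewrite mulr_ge0//= ler_piMr// ltW.
- exact: cvg_cst.
- by apply: cvg_expr; rewrite ger0_norm; lra.
Qed.

Variable U : probability TR R.
Hypothesis hU : uniform_law U.

(** Send the law to the line by [i], sample there with [quantile], and come back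
    by [s].  It is enough that [s] inverts [i] on a set of full measure. *)
Lemma realize d (T : measurableType d) (k : probability T R)
    (i : T -> TR) (s : TR -> T) (B : set T) :
  measurable_fun setT i -> measurable_fun setT s -> measurable B ->
  k B = 1%E -> {in B, cancel i s} ->
  exists psi : TR -> T, measurable_fun setT psi /\
    forall A, measurable A -> U (psi @^-1` A) = k A.
Proof.
move=> mi ms mB kB is_; have [q [mq qE]] := quantile hU (distribution k (mfun_of mi)).
exists (s \o q); split; first exact: measurableT_comp.
move=> A mA; rewrite comp_preimage qE; last exact: measurable_preimage.
rewrite /= /distribution /pushforward /= -(probability_setI1 _ mB kB); last first.
  exact/measurable_preimage/measurable_preimage.
rewrite -[RHS](probability_setI1 mA mB kB); congr (k _).
apply/seteqP; split=> x [] /= h Bx; split => //.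
  by rewrite -(is_ x)// inE.
by rewrite is_// inE.
Qed.

End realization.

(** * Two independent uniform variables from one *)

Section splitting.
Context (R : realType).
Local Notation TR := (measurableTypeR R).

Lemma measurable_boolR d (T : measurableType d) (b : T -> bool) :
  measurable_fun setT b -> measurable_fun setT (fun x => (b x)%:R : R).
Proof.
move=> mb; have -> : (fun x => (b x)%:R) = (fun x => if b x then (1:R) else 0).
  by apply/funext => x; case: (b x).
exact: measurable_fun_ifT.
Qed.

Lemma measurable_digit3 d (T : measurableType d) (f : T -> R) m :
  measurable_fun setT f -> measurable_fun setT (fun x => digit3 m (f x)).
Proof.
move=> mf; apply: measurable_fun_ler => //.
elim: m => [//|m IH]; rewrite /=.
apply: measurable_funM => //; apply: measurable_funB => //.
apply: measurable_boolR; exact: measurable_fun_ler.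
Qed.

Lemma measurable_digit2 d (T : measurableType d) (f : T -> R) m :
  measurable_fun setT f -> measurable_fun setT (fun x => digit2 m (f x)).
Proof.
move=> mf.
have mit n : measurable_fun setT (fun x => iter n (@rest2 R) (f x)).
  elim: n => [//|n IH]; rewrite /=.
  apply: measurable_funB; first exact: measurable_funM.
  apply: measurable_boolR; apply: measurable_fun_ler => //.
  exact: measurable_funM.
apply: measurable_fun_ler => //; exact: measurable_funM.
Qed.

Variable U : probability TR R.
Hypothesis hU : uniform_law U.

(** The map [i] interleaves the binary digits of two numbers and stores the
    result in base 3; it is inverted by [s] on the half-open square.  So the
    product law on the plane is realized by a function of one uniform variable,
    with coordinates [a] and [b]. *)
Lemma split_uniform : exists a b : TR -> TR,
  [/\ measurable_fun setT a, measurable_fun setT b &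
    forall A B, measurable A -> measurable B ->
      U (a @^-1` A `&` b @^-1` B) = (U A * U B)%E].
Proof.
pose k : probability (TR * TR)%type R := (U \x U)%E.
pose i (p : TR * TR) : TR :=
  bitsum 3^-1 (fun m => digit2 m./2 (if odd m then p.2 else p.1)).
pose dec (o : bool) (z : TR) : TR := 2^-1 * bitsum 2^-1 (fun m => digit3 (o + m.*2) z).
pose s z := (dec false z, dec true z).
have mi : measurable_fun setT i.
  apply: measurable_bitsum; first by lra.
  move=> m; apply: measurable_digit2; case: (odd m); [exact: measurable_snd|exact: measurable_fst].
have ms : measurable_fun setT s.
  have md o : measurable_fun setT (dec o).
    apply: measurable_funM => //; apply: measurable_bitsum; first by lra.
    move=> m; apply: measurable_digit3; exact: measurable_idTR.
  exact: measurable_fun_pair.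
pose B : set (TR * TR) := `[0, 1[%classic `*` `[0, 1[%classic.
have mB : measurable B by apply: measurableX; exact: measurable_itv.
have kB : k B = 1%E.
  have <- : (U `[0%R, 1%R[%classic * U `[0%R, 1%R[%classic)%E = 1%E.
    by rewrite !uniform01// mule1.
  by apply: product_measure1E; exact: measurable_itv.
have is_ : {in B, cancel i s}.
  move=> p; rewrite inE => -[/= p1 p2].
  have E o : dec o (i p) = if o then p.2 else p.1.
    rewrite /dec -[RHS]bitsum_digit2; last by case: o; move: p1 p2; rewrite /= !in_itv.
    congr (_ * bitsum _ _); apply/funext => m.
    rewrite digit3_bitsum oddD odd_double addbF oddb.
    by congr digit2; case: o; rewrite ?add0n ?add1n /= ?uphalf_double ?doubleK.
  by rewrite /s !E -surjective_pairing.
have [psi [mpsi psiE]] := realize hU mi ms mB kB is_.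
exists (fst \o psi), (snd \o psi); split.
- exact: measurableT_comp.
- exact: measurableT_comp.
- move=> A D mA mD; rewrite (psiE (A `*` D) (measurableX mA mD)).
  exact: product_measure1E.
Qed.

End splitting.

(** * Measurable choice of a least index *)

Section countable_choices.
Context dT (T : measurableType dT).

Lemma measurable_nat (f : T -> nat) :
  (forall n, measurable (f @^-1` [set n])) -> measurable_fun setT f.
Proof.
move=> mf _ A _; rewrite setTI.
have -> : f @^-1` A = \bigcup_(n in A) f @^-1` [set n].
  apply/seteqP; split=> x /=; first by exists (f x).
  by move=> [n An /= ->].
exact: bigcup_measurable.
Qed.

Lemma measurable_nat_fun d' (T' : measurableType d') (f : T -> nat) (g : nat -> T -> T') :
  measurable_fun setT f -> (forall n, measurable_fun setT (g n)) ->
  measurable_fun setT (fun x => g (f x) x).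
Proof.
move=> mf mg _ A mA; rewrite setTI.
have -> : (fun x => g (f x) x) @^-1` A =
    \bigcup_n (f @^-1` [set n] `&` g n @^-1` A).
  by apply/seteqP; split=> x /=; [exists (f x)|move=> [n _ /= [->]]].
apply: bigcup_measurable => n _; apply: measurableI.
  exact: (measurable_preimage mf).
exact: (measurable_preimage (mg n)).
Qed.

Definition least (p : nat -> bool) : nat :=
  if pselect (exists k, p k) is left h then ex_minn h else 0.

Lemma leastP (p : nat -> bool) : (exists k, p k) ->
  p (least p) /\ forall k, p k -> (least p <= k)%N.
Proof. by move=> h; rewrite /least; case: pselect => // h'; case: ex_minnP. Qed.

Lemma least_eq (p : nat -> bool) n : p n -> (forall k, (k < n)%N -> ~~ p k) -> least p = n.
Proof.
move=> pn ltn; have [|pl lel] := @leastP p; first by exists n.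
apply/eqP; rewrite eqn_leq lel// leqNgt; apply/negP => /ltn.
by rewrite pl.
Qed.

Lemma measurable_least (p : T -> nat -> bool) :
  (forall k, measurable_fun setT (p ^~ k)) -> measurable_fun setT (fun x => least (p x)).
Proof.
move=> mp; have mp' k : measurable [set x | p x k].
  by have := mp k measurableT [set true]; rewrite setTI; exact.
apply: measurable_nat => n.
have -> : (fun x => least (p x)) @^-1` [set n] =
   ([set x | p x n] `&` \bigcap_(k < n) ~` [set x | p x k]) `|`
   ((\bigcap_k ~` [set x | p x k]) `&` [set _ | n = 0%N]).
  apply/seteqP; split=> x /=.
    have [h|h] := pselect (exists k, p x k).
      have [pl lel] := leastP h.
      by move=> <-; left; split => // k /= kn pk; have := lel _ pk; rewrite leqNgt kn.
    rewrite /least; case: pselect => // _ <-; right; split => // k _ /= pk.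
    by apply: h; exists k.
  move=> [[pn h]|[h ->]]; first by apply: least_eq => // k /h /negP.
  by rewrite /least; case: pselect => // -[k pk]; have := h k Logic.I.
apply: measurableU.
  apply: measurableI => //; apply: bigcap_measurableType => k _; exact: measurableC.
have [->|n0] := eqVneq n 0%N.
  rewrite (_ : [set _ | 0%N = 0%N] = setT) ?setIT; last by apply/seteqP; split.
  by apply: bigcapT_measurable => k; exact: measurableC.
rewrite (_ : [set _ | n = 0%N] = set0) ?setI0//.
by apply/seteqP; split=> // x /= /eqP; rewrite (negbTE n0).
Qed.

Definition unpair (m : nat) : nat * nat := odflt (0%N, 0%N) (unpickle m).

Lemma unpairK : cancel pickle unpair.
Proof. by move=> p; rewrite /unpair pickleK. Qed.

End countable_choices.

(** * Polish spaces as Borel retracts of the line *)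

Section polish.
Context (R : realType) (X : ptopologicalType).
Local Notation TR := (measurableTypeR R).
Variable d : X -> X -> R.
Hypothesis dmetric : metric_on d.
Hypothesis dtop : induces_topology d.
Hypothesis dcomplete : complete_metric d.

Let d0 x : d x x = 0. Proof. by case: dmetric => + _ _ => /(_ x x) [_]; exact. Qed.
Let dC x y : d x y = d y x. Proof. by case: dmetric. Qed.
Let dtri y x z : d x z <= d x y + d y z. Proof. by case: dmetric. Qed.
Let d_ge0 x y : 0 <= d x y.
Proof. by have := dtri y x x; rewrite d0 (dC y x); lra. Qed.
Let d_eq0 x y : d x y = 0 -> x = y.
Proof. by case: dmetric => + _ _ => /(_ x y) [+ _]. Qed.

Definition dball x e := [set y | d x y < e].

Lemma open_dball x e : open (dball x e).
Proof.
rewrite openE => y /= xy; apply/dtop; exists (e - d x y); first by rewrite subr_gt0.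
by move=> z /= yz; rewrite /dball/= (le_lt_trans (dtri y x z))// -ltrBrDl.
Qed.

Lemma measurable_dball x e : measurable (dball x e : set (borel X)).
Proof. by apply: sub_sigma_algebra; exact: open_dball. Qed.

Lemma open_dballP (O : set X) x : open O -> O x -> exists2 e, 0 < e & dball x e `<=` O.
Proof. by rewrite openE => oO Ox; apply/dtop; exact: oO. Qed.

(** Balls of radius half the least distance between two of the points. *)
Lemma disjoint_nbhs (m : nat) (x : 'I_m -> X) : injective x ->
  exists O : 'I_m -> set X, [/\ forall i, open (O i), forall i, O i (x i) &
    forall i j, i != j -> O i `&` O j = set0].
Proof.
move=> xinj.
pose e : R := \big[Num.min/1]_(p : 'I_m * 'I_m | p.1 != p.2) d (x p.1) (x p.2).
have e0 : 0 < e.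
  apply: lt_bigmin => // -[i j] /= ij; rewrite lt_neqAle d_ge0 andbT eq_sym.
  by apply: contra_neq ij => /d_eq0/xinj.
have ele i j : i != j -> e <= d (x i) (x j).
  by move=> ij; exact: (@bigmin_le_cond _ _ _ _ (i, j)).
exists (fun i => dball (x i) (e / 2)); split=> [i|i|i j ij].
- exact: open_dball.
- by rewrite /dball /= d0 divr_gt0.
- rewrite -subset0 => y; rewrite /dball => -[/= iy jy].
  have := ele i j ij; rewrite leNgt => /negP; apply.
  by rewrite (le_lt_trans (dtri y _ _))// (dC y); lra.
Qed.

Lemma dense_enum : separable X ->
  exists q : nat -> X, forall x e, 0 < e -> exists k, d x (q k) < e.
Proof.
move=> [D cD dD]; have := cD => /pcard_leP/injfunPex[/= f _ finj].
exists (fun k => if pselect (exists2 x, D x & f x = k) is left h then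
   projT1 (cid2 h) else point) => x e e0.
have [y [xy Dy]] : dball x e `&` D !=set0.
  by apply: dD; [exists x; rewrite /dball/= d0|exact: open_dball].
exists (f y); case: pselect => [h|]; last by case; exists y.
case: (cid2 h) => z Dz /= fz; suff -> : z = y by [].
by apply: finj; rewrite ?inE.
Qed.

Variable q : nat -> X.
Hypothesis qdense : forall x e, 0 < e -> exists k, d x (q k) < e.

Let eps (n : nat) : R := 2^-1 ^+ n.
Let eps_gt0 n : 0 < eps n. Proof. by rewrite exprn_gt0. Qed.

Let epsS n : eps n.+1 = eps n / 2. Proof. by rewrite /eps exprS mulrC. Qed.

Lemma eps_small e : 0 < e -> exists n, eps n < e.
Proof.
move=> e0; have : eps n @[n --> \oo] --> (0 : R).
  by apply: cvg_expr; rewrite ger0_norm; lra.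
move=> /cvgrPdist_lt /(_ e e0) [n _ /(_ n (leqnn n))] /=; rewrite sub0r normrN.
by rewrite ger0_norm; [exists n|exact: ltW].
Qed.

(** A point is coded by the bits that tell, for every [n] and [k], whether it is
    closer than [eps n] to [q k]. *)
Let code (x : X) : TR :=
  bitsum 3^-1 (fun m => d x (q (unpair m).2) < eps (unpair m).1).

Let close (n : nat) (y : TR) (k : nat) := digit3 (pickle (n, k)) y.

Let closeE n x k : close n (code x) k = (d x (q k) < eps n).
Proof. by rewrite /close digit3_bitsum unpairK. Qed.

Let near_idx n y := least (close n y).

(** On the code of [x] the index [near_idx n] points to an approximation of [x]
    of precision [eps n].  On an arbitrary real number these approximations need
    not converge; standing still whenever the next one is far away yields a
    sequence that always does. *)
Fixpoint settle (n : nat) (y : TR) : nat :=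
  if n is n'.+1 then
    if d (q (near_idx n y)) (q (settle n' y)) < 2 * eps n' then near_idx n y
    else settle n' y
  else near_idx 0 y.

Let measurable_near n : measurable_fun setT (near_idx n).
Proof. by apply: measurable_least => k; apply: measurable_digit3; exact: measurable_idTR. Qed.

Let measurable_settle n : measurable_fun setT (settle n).
Proof.
elim: n => [|n IH] /=; first exact: measurable_near.
apply: (measurable_nat_fun (f := near_idx n.+1) (g := fun k y =>
  if d (q k) (q (settle n y)) < 2 * eps n then k else settle n y)) => // k.
apply: (measurable_nat_fun (f := settle n) (g := fun j _ =>
  if d (q k) (q j) < 2 * eps n then k else j)) => // j.
Qed.

Let settle_step n y : d (q (settle n y)) (q (settle n.+1 y)) <= 2 * eps n.
Proof.
rewrite /=; case: ifPn => [h|_]; first by rewrite dC ltW.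
by rewrite d0 mulr_ge0// ltW.
Qed.

Let settle_dist n j y : d (q (settle n y)) (q (settle (n + j) y)) <= 4 * eps n - 4 * eps (n + j).
Proof.
elim: j => [|j IH]; first by rewrite addn0 d0 subrr.
rewrite addnS (le_trans (dtri (q (settle (n + j) y)) _ _))//.
by rewrite (le_trans (lerD IH (settle_step _ _)))// epsS; lra.
Qed.

Let settle_cvg y : exists l : X, (fun n => q (settle n y)) @ \oo --> l.
Proof.
apply: dcomplete => e e0.
have [N Ne] := @eps_small (e / 8) (divr_gt0 e0 (ltr0n _ 8)).
exists N => m n /subnKC <- /subnKC <-.
rewrite (le_lt_trans (dtri (q (settle N y)) _ _))// dC.
have := settle_dist N (m - N) y; have := settle_dist N (n - N) y.
have := eps_gt0 (N + (m - N)); have := eps_gt0 (N + (n - N)).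
by lra.
Qed.

Let decode (y : TR) : X := projT1 (cid (settle_cvg y)).

Let decode_dist n y : d (q (settle n y)) (decode y) <= 4 * eps n.
Proof.
rewrite /decode; case: cid => l /= ul.
apply/ler_addgt0Pr => e e0.
have : nbhs l (dball l e) by apply/dtop; exists e.
move=> /ul [N _ /(_ (n + N)%N (leq_addl _ _))]; rewrite /dball /= dC => h.
rewrite (le_trans (dtri (q (settle (n + N) y)) _ _))//.
have := settle_dist n N y; have := eps_gt0 (n + N)%N.
by move: h; rewrite dC; lra.
Qed.

Let measurable_code : measurable_fun setT (code : borel X -> TR).
Proof.
apply: measurable_bitsum; first by lra.
move=> m; apply: (measurable_fun_bool true).
rewrite (_ : _ `&` _ = dball (q (unpair m).2) (eps (unpair m).1)).
  exact: measurable_dball.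
by rewrite setTI; apply/seteqP; split=> x /=; rewrite /dball /= dC.
Qed.

Let measurable_decode : measurable_fun setT (decode : TR -> borel X).
Proof.
apply: (measurability _ (erefl : @measurable _ (borel X) = <<s @open X >>)).
move=> _ [W oO <-]; rewrite setTI.
(* An open set contains the limit iff it contains a ball around some term
   that is larger than the remaining error [4 * eps n]. *)
have -> : decode @^-1` W = \bigcup_n (settle n @^-1`
    [set k | dball (q k) (5 * eps n) `<=` W]).
  apply/seteqP; split=> y /=.
    move=> /(open_dballP oO) [e e0 eO].
    have [n ne] := @eps_small (e / 10) (divr_gt0 e0 (ltr0n _ 10)).
    exists n => // z /=; rewrite /dball/= => h; apply: eO; rewrite /dball/=.
    rewrite (le_lt_trans (dtri (q (settle n y)) _ _))// dC.
    by have := decode_dist n y; lra.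
  move=> [n _ /=]; apply; rewrite /dball/= (le_lt_trans (decode_dist n y))//.
  by rewrite ltr_pM2r// ltr_nat.
apply: bigcup_measurable => n _.
exact: (measurable_preimage (measurable_settle n)).
Qed.

Let codeK : cancel code decode.
Proof.
move=> x.
have nearP n : d x (q (near_idx n (code x))) < eps n.
  have [k xk] := qdense x (eps_gt0 n).
  have [|+ _] := @leastP (close n (code x)); first by exists k; rewrite closeE.
  by rewrite closeE.
have sn n : settle n (code x) = near_idx n (code x).
  elim: n => [//|n IH] /=; rewrite IH ifT//.
  rewrite (le_lt_trans (dtri x _ _))//.
  have := nearP n; have := nearP n.+1; rewrite (dC _ x).
  by rewrite epsS; have := eps_gt0 n; lra.
apply: d_eq0; apply/eqP; rewrite eq_le d_ge0 andbT.
apply/ler_addgt0Pr => e e0; rewrite add0r.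
have [n ne] := @eps_small (e / 10) (divr_gt0 e0 (ltr0n _ 10)).
rewrite (le_trans (dtri (q (settle n (code x))) _ _))// dC.
have := decode_dist n (code x); have := nearP n; rewrite -sn.
have := eps_gt0 n; rewrite dC; lra.
Qed.

(** Coding by [code], decoding by the limit of [settle]: the limit exists by
    completeness. *)
Lemma metric_retract : exists (i : borel X -> TR) (s : TR -> borel X),
  [/\ measurable_fun setT i, measurable_fun setT s & cancel i s].
Proof. by exists code, decode. Qed.

Lemma countable_base : exists V : nat -> set X, (forall m, open (V m)) /\
  forall O x, open O -> O x -> exists2 m, V m x & V m `<=` O.
Proof.
exists (fun m => dball (q (unpair m).2) (eps (unpair m).1)); split.
  by move=> m; exact: open_dball.
move=> O x oO Ox; have [e e0 eO] := open_dballP oO Ox.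
have [n ne] := @eps_small (e / 2) (divr_gt0 e0 (ltr0n _ 2)).
have [k xk] := qdense x (eps_gt0 n).
exists (pickle (n, k)); rewrite unpairK /= /dball /=; first by rewrite dC.
move=> z /= kz; apply: eO; rewrite /dball/=.
by rewrite (le_lt_trans (dtri (q k) _ _))//; lra.
Qed.

End polish.

(** * Poisson many independent points *)

Section independence.
Context (R : realType).
Local Notation TR := (measurableTypeR R).
Variable U : probability TR R.
Variables a b : TR -> TR.
Hypothesis ma : measurable_fun setT a.
Hypothesis mb : measurable_fun setT b.
Hypothesis ab : forall A B, measurable A -> measurable B ->
  U (a @^-1` A `&` b @^-1` B) = (U A * U B)%E.

Lemma fst_law A : measurable A -> U (a @^-1` A) = U A.
Proof.
move=> mA; have := ab mA measurableT.
by rewrite preimage_setT setIT probability_setT mule1.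
Qed.

Lemma snd_law A : measurable A -> U (b @^-1` A) = U A.
Proof.
move=> mA; have := ab measurableT mA.
by rewrite preimage_setT setTI probability_setT mul1e.
Qed.

(** Iterating [b] and reading off [a] turns one uniform variable into a sequence
    of independent ones ([draws_law]). *)
Definition draw (n : nat) (u : TR) : TR := a (iter n b u).

Lemma drawS n u : draw n.+1 u = draw n (b u).
Proof. by rewrite /draw iterSr. Qed.

Lemma measurable_draw n : measurable_fun setT (draw n).
Proof.
apply: measurableT_comp => //; elim: n => [|n IH]; first exact: measurable_id.
exact: measurableT_comp.
Qed.

Lemma draw_law n A : measurable A -> U (draw n @^-1` A) = U A.
Proof.
move=> mA; elim: n => [|n IH]; first exact: fst_law.
have -> : draw n.+1 @^-1` A = b @^-1` (draw n @^-1` A).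
  by apply/funext => u; rewrite /= drawS.
by rewrite snd_law//; exact: (measurable_preimage (measurable_draw n)).
Qed.

Lemma measurable_draws (n : nat) (B : nat -> set TR) :
  (forall i, measurable (B i)) ->
  measurable [set u | forall i, (i < n)%N -> B i (draw i u)].
Proof.
move=> mB; have -> : [set u | forall i, (i < n)%N -> B i (draw i u)] =
  \bigcap_(i < n) draw i @^-1` (B i) by [].
apply: bigcap_measurableType => k _.
exact: (measurable_preimage (measurable_draw k)).
Qed.

Lemma draws_law (n : nat) (B : nat -> set TR) (p : nat -> R) :
  (forall i, measurable (B i)) -> (forall i, U (B i) = (p i)%:E) ->
  U [set u | forall i, (i < n)%N -> B i (draw i u)] = (\prod_(i < n) p i)%:E.
Proof.
elim: n B p => [|n IH] B p mB Bp.
  by rewrite big_ord0 (_ : [set u | _] = setT) ?probability_setT//; apply/seteqP; split.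
have -> : [set u | forall i, (i < n.+1)%N -> B i (draw i u)] =
    a @^-1` (B 0%N) `&` b @^-1` [set u | forall i, (i < n)%N -> B i.+1 (draw i u)].
  apply/seteqP; split=> u /=.
    by move=> h; split=> [|i ni]; [exact: (h 0%N)|rewrite -drawS; exact: h].
  by move=> [h0 h] [|i] ni; [exact: h0|rewrite drawS; exact: h].
rewrite ab//; last by apply: (@measurable_draws n (fun i => B i.+1)) => i; exact: mB.
by rewrite Bp (IH (fun i => B i.+1) (fun i => p i.+1))// big_ord_recl EFinM.
Qed.

Variable N : TR -> nat.
Hypothesis mN : measurable_fun setT N.
Hypothesis N_law : forall n, U (N @^-1` [set n]) = (expR (- 1) / n`!%:R)%:E.

Let mNn m : measurable (N @^-1` [set m]).
Proof. exact: (@measurable_preimage _ _ _ _ N [set m] mN). Qed.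

(** The source [w] of a cell is read as a sequence of draws: the first one
    determines the number of points, a Poisson variable of mean 1, and the
    following ones are the points. *)
Definition cell_void (Z : set TR) : set TR :=
  [set w | forall n, (n < N (draw 0 w))%N -> ~ Z (draw n.+1 w)].

Lemma cell_voidE Z : cell_void Z = \bigcup_m (a @^-1` (N @^-1` [set m]) `&`
  b @^-1` [set w | forall n, (n < m)%N -> (~` Z) (draw n w)]).
Proof.
apply/seteqP; split=> w.
  move=> h; exists (N (draw 0 w)) => //; split => //= n nN.
  by rewrite -drawS; exact: h.
by move=> [m _ /= [<-] h] n nN; rewrite drawS; exact: h.
Qed.

Lemma measurable_cell_void Z : measurable Z -> measurable (cell_void Z).
Proof.
move=> mZ; rewrite cell_voidE; apply: bigcup_measurable => m _.
apply: measurableI; first exact: (measurable_preimage ma (mNn m)).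
apply: (measurable_preimage mb); apply: (@measurable_draws m (fun=> ~` Z)) => i.
exact: measurableC.
Qed.

(** [n] points avoid [Z] with probability [(1 - z) ^+ n], and averaging over the
    Poisson number of points gives an exponential series. *)
Lemma cell_void_law Z (z : R) : measurable Z -> U Z = z%:E ->
  U (cell_void Z) = (expR (- z))%:E.
Proof.
move=> mZ Zz; rewrite cell_voidE measure_semi_bigcup; last 3 first.
- move=> m; apply: measurableI; first exact: (measurable_preimage ma (mNn m)).
  apply: (measurable_preimage mb); apply: (@measurable_draws m (fun=> ~` Z)) => i.
  exact: measurableC.
- by move=> i j _ _ [w [[/= <- _] [<- _]]].
- by rewrite -cell_voidE; exact: measurable_cell_void.
have E m : U (a @^-1` (N @^-1` [set m]) `&`
    b @^-1` [set w | forall n, (n < m)%N -> (~` Z) (draw n w)]) =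
    (expR (-1) * exp_coeff (1 - z) m)%:E.
  rewrite ab; last 2 first.
  - exact: mNn.
  - by apply: (@measurable_draws _ (fun=> ~` Z)) => i; exact: measurableC.
  rewrite N_law (@draws_law m (fun=> ~` Z) (fun=> 1 - z)); last 2 first.
  - by move=> i; exact: measurableC.
  - by move=> i; rewrite (probability_setC U mZ) Zz.
  rewrite prodr_const card_ord -EFinM /exp_coeff/=; congr EFin.
  by rewrite mulrA mulrAC.
rewrite (eq_eseriesr (fun m _ => E m)).
have -> : expR (- z) = expR (-1) * expR (1 - z) by rewrite -expRD; congr expR; lra.
apply: cvg_lim => //.
have -> : (fun n => \sum_(0 <= i < n) (expR (-1) * exp_coeff (1 - z) i)%:E)%E =
  EFin \o (fun n => expR (-1) * series (exp_coeff (1 - z)) n).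
  by apply/funext => n /=; rewrite sumEFin; congr EFin; rewrite /series /= mulr_sumr.
apply: cvg_EFin; first by exact: nearW.
by apply: cvgMr; exact: is_cvg_series_exp_coeff.
Qed.

(** A round has countably many cells, with independent sources. *)
Definition round_void (Z : nat -> set TR) : set TR :=
  [set u | forall i, cell_void (Z i) (draw i u)].

Lemma measurable_round_void Z : (forall i, measurable (Z i)) -> measurable (round_void Z).
Proof.
move=> mZ; have -> : round_void Z = \bigcap_i draw i @^-1` cell_void (Z i).
  by apply/seteqP; split=> u h i => [_|]; apply: h.
apply: bigcapT_measurable => i.
by apply: (measurable_preimage (measurable_draw i)); exact: measurable_cell_void.
Qed.

(** The void probabilities of finitely many cells multiply; the infinite
    intersection is a limit of a decreasing sequence of events. *)
Lemma round_void_law Z (z : nat -> R) (c : R) :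
  (forall i, measurable (Z i)) -> (forall i, U (Z i) = (z i)%:E) ->
  (fun n => \sum_(i < n) z i) @ \oo --> c ->
  U (round_void Z) = (expR (- c))%:E.
Proof.
move=> mZ Zz zc.
pose F n := [set u | forall i, (i < n)%N -> cell_void (Z i) (draw i u)].
have mF n : measurable (F n).
  apply: (@measurable_draws n (fun i => cell_void (Z i))) => i.
  exact: measurable_cell_void.
have FE n : U (F n) = (expR (- \sum_(i < n) z i))%:E.
  rewrite (@draws_law n (fun i => cell_void (Z i)) (fun i => expR (- z i))).
  - by rewrite -expR_sum sumrN.
  - by move=> i; exact: measurable_cell_void.
  - by move=> i; exact: cell_void_law.
have -> : round_void Z = \bigcap_n F n.
  apply/seteqP; split=> u h; first by move=> n _ i _; exact: h.
  by move=> i; exact: (h i.+1 Logic.I i).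
have c1 : U (F n) @[n --> \oo] --> U (\bigcap_n F n).
  apply: nonincreasing_cvg_mu => //.
  - by rewrite (le_lt_trans (probability_le1 _ _)) ?ltry.
  - exact: bigcapT_measurable.
  - by move=> m n mn; apply/subsetPset => u h i im; apply: h; exact: leq_trans mn.
have c2 : U (F n) @[n --> \oo] --> (expR (- c))%:E.
  rewrite (funext FE); apply: cvg_EFin; first exact: nearW.
  apply: continuous_cvg; first exact: continuous_expR.
  exact: cvgN.
exact: cvg_unique c1 c2.
Qed.

End independence.

(** * The earliest point of a region in one round *)

Lemma probability_setU d (T : measurableType d) (R : realType) (P : probability T R) A B :
  measurable A -> measurable B -> A `&` B = set0 -> P (A `|` B) = (P A + P B)%E.
Proof. exact: measureU. Qed.

Section race.
Context (R : realType).
Local Notation TR := (measurableTypeR R).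
Variable U : probability TR R.
Hypothesis hU : uniform_law U.
Variables a b : TR -> TR.
Hypothesis ma : measurable_fun setT a.
Hypothesis mb : measurable_fun setT b.
Hypothesis ab : forall A B, measurable A -> measurable B ->
  U (a @^-1` A `&` b @^-1` B) = (U A * U B)%E.
Variable N : TR -> nat.
Hypothesis mN : measurable_fun setT N.
Hypothesis N_law : forall n, U (N @^-1` [set n]) = (expR (- 1) / n`!%:R)%:E.
Context dE (E : measurableType dE).
Variable th : nat -> TR -> E.
Hypothesis mth : forall i, measurable_fun setT (th i).

Local Notation draw := (draw a b).
Local Notation cell_void := (cell_void a b N).
Local Notation round_void := (round_void a b N).

(** The points of a round are numbered by the codes of the pairs (cell, rank in
    the cell).  The source of a point splits into its location, placed by the map
    [th] of the cell, and its arrival time, uniform in the unit interval.  Not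
    every number is the number of a point: this is what [active] checks. *)
Definition src (k : nat) (u : TR) : TR := draw (unpair k).2.+1 (draw (unpair k).1 u).
Definition loc k u : E := th (unpair k).1 (a (src k u)).
Definition tm k u : TR := b (src k u).
Definition active k u : bool :=
  (pickle (unpair k) == k) && ((unpair k).2 < N (draw 0 (draw (unpair k).1 u)))%N.

Definition zone (A : set E) (s : R) (i : nat) : set TR :=
  [set v | A (th i (a v)) /\ 0 <= b v < s].

Lemma measurable_src k : measurable_fun setT (src k).
Proof. by apply: measurableT_comp; exact: measurable_draw. Qed.

Lemma measurable_loc k : measurable_fun setT (loc k).
Proof.
apply: (measurableT_comp (mth _)); apply: (measurableT_comp ma).
exact: measurable_src.
Qed.

Lemma measurable_tm k : measurable_fun setT (tm k).
Proof. by apply: (measurableT_comp mb); exact: measurable_src. Qed.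

Lemma measurable_active k : measurable [set u | active k u].
Proof.
have -> : [set u | active k u] = (fun u => N (draw 0 (draw (unpair k).1 u))) @^-1`
    [set n | (pickle (unpair k) == k) && ((unpair k).2 < n)%N] by [].
apply: measurable_preimage => //; apply: (measurableT_comp mN).
by apply: measurableT_comp; exact: measurable_draw.
Qed.

Lemma zoneE A s i : zone A s i = a @^-1` (th i @^-1` A) `&` b @^-1` `[0, s[%classic.
Proof. by apply/seteqP; split=> v /=; rewrite in_itv. Qed.

Lemma measurable_zone A s i : measurable A -> measurable (zone A s i).
Proof.
move=> mA; rewrite zoneE; apply: measurableI.
  exact: (measurable_preimage ma (measurable_preimage (mth i) mA)).
by apply: (measurable_preimage mb); exact: measurable_itv.
Qed.

Lemma round_voidP Z u :
  round_void Z u <-> forall k, active k u -> ~ Z (unpair k).1 (src k u).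
Proof.
split=> [h k /andP[_ kN]|h i n nN]; first exact: h kN.
have := h (pickle (i, n)); rewrite /active /src unpairK eqxx /=; exact.
Qed.

Lemma measurable_zone_src A s k : measurable A ->
  measurable [set u | zone A s (unpair k).1 (src k u)].
Proof.
by move=> mA; exact: (measurable_preimage (measurable_src k) (measurable_zone _ _ mA)).
Qed.

(** The earliest point of [J] in the round.  Ties in time, although of
    probability 0, are broken by the number of the point, so that the earliest
    point is unique. *)
Definition best (J : set E) (u : TR) (k : nat) : Prop :=
  [/\ active k u, zone J 1 (unpair k).1 (src k u) &
    forall l, active l u -> zone J 1 (unpair l).1 (src l u) ->
      tm k u < tm l u \/ (tm k u = tm l u /\ (k <= l)%N)].

Lemma measurable_best J k : measurable J -> measurable [set u | best J u k].
Proof.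
move=> mJ.
have -> : [set u | best J u k] = [set u | active k u] `&`
  [set u | zone J 1 (unpair k).1 (src k u)] `&` \bigcap_l
   (~` [set u | active l u] `|` ~` [set u | zone J 1 (unpair l).1 (src l u)] `|`
    ([set u | tm k u < tm l u] `|` ([set u | tm k u = tm l u] `&` [set _ | (k <= l)%N]))).
  apply/seteqP; split=> u /=.
    move=> [h1 h2 h3]; split=> // l _ /=.
    have [al|nl] := pselect (active l u); last by left; left.
    have [zl|nzl] := pselect (zone J 1 (unpair l).1 (src l u)); last by left; right.
    by right; exact: h3.
  by move=> [[h1 h2] h3]; split=> // l al zl; have [[//|//]|] := h3 l Logic.I.
apply: measurableI.
  apply: measurableI; [exact: measurable_active|exact: measurable_zone_src].
apply: bigcapT_measurable => l; apply: measurableU.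
  apply: measurableU; apply: measurableC; [exact: measurable_active|exact: measurable_zone_src].
have lt_m : measurable [set u | tm k u < tm l u].
  have := @measurable_fun_ltr _ _ R setT _ _ (measurable_tm k) (measurable_tm l).
  by move=> /(_ measurableT [set true] Logic.I); rewrite setTI; exact.
have eq_m : measurable [set u | tm k u = tm l u].
  have := @measurable_fun_eqr _ _ R setT _ _ (measurable_tm k) (measurable_tm l).
  move=> /(_ measurableT [set true] Logic.I); rewrite setTI.
  by rewrite (_ : _ @^-1` _ = [set u | tm k u = tm l u])//; apply/seteqP; split=> u /eqP.
apply: measurableU => //; apply: measurableI => //.
by case: (k <= l)%N; [rewrite set_true|rewrite set_false].
Qed.

Lemma best_unique J u k l : best J u k -> best J u l -> k = l.
Proof.
move=> [ak zk hk] [al zl hl].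
have := hk l al zl; have := hl k ak zk.
move=> [h1 [h2|[h2 _]]|[h1 kl] [h2|[_ lk]]].
- by have := lt_trans h1 h2; rewrite ltxx.
- by move: h1; rewrite h2 ltxx.
- by move: h2; rewrite h1 ltxx.
- by apply/eqP; rewrite eqn_leq kl lk.
Qed.

Lemma best_sub J K u k : K `<=` J -> best J u k -> K (loc k u) -> best K u k.
Proof.
move=> KJ [ak [Jk tk] hk] Kk; split=> // l al [Kl tl].
by apply: hk => //; split => //; exact: KJ.
Qed.

(** The intensity of the points of a round: a cell contributes the law of its
    location.  As a limit of real numbers it is also the statement that the
    intensity of [A] is finite. *)
Definition mass (A : set E) (al : R) : Prop :=
  (fun n => \sum_(i < n) fine (U (th i @^-1` A))) @ \oo --> al.

Lemma mass_ge0 A al : mass A al -> 0 <= al.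
Proof.
move=> h; apply: (cvgr_to_ge h); apply: nearW => n; apply: sumr_ge0 => i _.
exact: fine_ge0.
Qed.

Lemma massU A B al be : measurable A -> measurable B -> A `&` B = set0 ->
  mass A al -> mass B be -> mass (A `|` B) (al + be).
Proof.
move=> mA mB AB hA hB; rewrite /mass.
rewrite (_ : (fun n => _) = (fun n => \sum_(i < n) fine (U (th i @^-1` A))) \+
  (fun n => \sum_(i < n) fine (U (th i @^-1` B)))); first exact: cvgD.
apply/funext => n /=; rewrite -big_split /=; apply: eq_bigr => i _.
have mA' := measurable_preimage (mth i) mA.
have mB' := measurable_preimage (mth i) mB.
rewrite preimage_setU probability_setU//; first by rewrite fineD ?fin_num_measure.
by rewrite -preimage_setI AB preimage_set0.
Qed.

Lemma zone_law A s i : measurable A -> 0 <= s <= 1 ->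
  U (zone A s i) = (fine (U (th i @^-1` A)) * s)%:E.
Proof.
move=> mA /andP[s0 s1]; have mA' := measurable_preimage (mth i) mA.
have mI : measurable (`[0, s[%classic : set TR) by exact: measurable_itv.
rewrite zoneE (ab mA' mI).
by rewrite hU// subr0 EFinM fineK// fin_num_measure.
Qed.

Lemma void2_law A B al be s t : measurable A -> measurable B -> A `&` B = set0 ->
  mass A al -> mass B be -> 0 <= s <= 1 -> 0 <= t <= 1 ->
  U (round_void (fun i => zone A s i `|` zone B t i)) = (expR (- (al * s + be * t)))%:E.
Proof.
move=> mA mB AB hA hB s01 t01.
apply: (round_void_law ma mb ab mN N_law
  (z := fun i => fine (U (th i @^-1` A)) * s + fine (U (th i @^-1` B)) * t)).
- by move=> i; apply: measurableU; exact: measurable_zone.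
- move=> i; rewrite probability_setU ?zone_law//; [exact: measurable_zone|exact: measurable_zone|].
  rewrite -subset0 => v [[Av _] [Bv _]].
  by have : (A `&` B) (th i (a v)) by []; rewrite AB.
- rewrite (_ : (fun n => _) = (fun n => (\sum_(i < n) fine (U (th i @^-1` A))) * s) \+
  (fun n => (\sum_(i < n) fine (U (th i @^-1` B))) * t)).
    by apply: cvgD; apply: cvgMl.
  by apply/funext => n /=; rewrite big_split /= !mulr_suml.
Qed.

Lemma mass0 : mass set0 0.
Proof.
rewrite /mass (_ : (fun n => _) = fun=> 0); first exact: cvg_cst.
by apply/funext => n; rewrite big1// => i _; rewrite preimage_set0 measure0.
Qed.

Lemma void_law A al s : measurable A -> mass A al -> 0 <= s <= 1 ->
  U (round_void (zone A s)) = (expR (- (al * s)))%:E.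
Proof.
move=> mA hA s01.
have := void2_law mA measurable0 (setI0 A) hA mass0 s01 s01.
rewrite mul0r addr0 => <-; congr (U (round_void _)).
by apply/funext => i; rewrite [X in _ `|` X](_ : _ = set0) ?setU0//; apply/seteqP; split=> v // [].
Qed.

Lemma massD J A c al : measurable J -> measurable A -> A `<=` J ->
  mass J c -> mass A al -> mass (J `\` A) (c - al).
Proof.
move=> mJ mA AJ hJ hA; rewrite /mass.
rewrite (_ : (fun n => _) = (fun n => \sum_(i < n) fine (U (th i @^-1` J))) \-
  (fun n => \sum_(i < n) fine (U (th i @^-1` A)))); first exact: cvgB.
apply/funext => n /=; rewrite -sumrB; apply: eq_bigr => i _.
have mA' := measurable_preimage (mth i) mA.
have mJ' := measurable_preimage (mth i) mJ.
rewrite -fineB ?fin_num_measure//; congr fine; apply/eqP.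
have -> : U (th i @^-1` (J `\` A)) = (U (th i @^-1` J `\` th i @^-1` A)) by [].
rewrite eq_sym; apply/eqP/esym; rewrite measureD//; last by rewrite (le_lt_trans (probability_le1 _ _)) ?ltry.
by rewrite setIidr//; exact: preimage_subset.
Qed.

(** The event that no point of [J] arrives before [j / m] and some point of [A]
    arrives before [j.+1 / m].  It is a difference of two void events. *)
Lemma race_slice J A c al (m j : nat) : measurable J -> measurable A -> A `<=` J ->
  mass J c -> mass A al -> (j < m)%N ->
  U (round_void (zone J (j%:R / m%:R)) `\` round_void (fun i =>
       zone A (j.+1%:R / m%:R) i `|` zone (J `\` A) (j%:R / m%:R) i)) =
  (expR (- (c / m%:R)) ^+ j * (1 - expR (- (al / m%:R))))%:E.
Proof.
move=> mJ mA AJ hJ hA jm.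
have m0 : (0 : R) < m%:R by rewrite ltr0n (leq_ltn_trans _ jm).
have s01 : 0 <= (j%:R / m%:R : R) <= 1.
  by rewrite divr_ge0//= ler_pdivrMr// mul1r ler_nat ltnW.
have t01 : 0 <= (j.+1%:R / m%:R : R) <= 1.
  by rewrite divr_ge0//= ler_pdivrMr// mul1r ler_nat.
set V1 := round_void (zone J _); set V2 := round_void _.
have mV1 : measurable V1.
  by apply: measurable_round_void => // i; exact: measurable_zone.
have mV2 : measurable V2.
  apply: measurable_round_void => // i.
  by apply: measurableU; apply: measurable_zone => //; exact: measurableD.
have V21 : V2 `<=` V1.
  move=> u /round_voidP h; apply/round_voidP => k ak [Jk tk]; apply: (h k ak).
  have [Ak|nAk] := pselect (A (th (unpair k).1 (a (src k u)))); last by right.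
  left; split=> //; case/andP: tk => -> /= /lt_le_trans; apply.
  by rewrite ler_pM2r ?invr_gt0// ler_nat.
have -> : U (V1 `\` V2) = (U V1 - U V2)%E.
  rewrite measureD//; first by rewrite setIidr.
  by rewrite (le_lt_trans (probability_le1 _ _)) ?ltry.
rewrite (void_law mJ hJ s01).
rewrite (void2_law mA _ _ hA (massD mJ mA AJ hJ hA) t01 s01); last 2 first.
- exact: measurableD.
- by rewrite setDE setICA setICr setI0.
rewrite -EFinB; congr EFin; rewrite -expRM_natl mulrBr mulr1 -expRD.
congr (expR _ - expR _); first by rewrite mulrN mulrCA mulrA.
rewrite -natr1; field.
by rewrite gt_eqF.
Qed.

(** The right-hand side is the share [al / c] of [A] in [J], times the
    probability that a point of [J] arrives.  When the earliest point of [J] is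
    in [A], one of [m] slices of time satisfies the event of [race_slice]; the
    probabilities of these events form a geometric series, whose sum tends to the
    bound as [m] grows. *)
Lemma race_bound J A c al : measurable J -> measurable A -> A `<=` J ->
  mass J c -> mass A al -> 0 < c ->
  (U [set u | exists2 k, best J u k & A (loc k u)] <= (al / c * (1 - expR (- c)))%:E)%E.
Proof.
move=> mJ mA AJ hJ hA c0.
set D := [set u | _].
have mD : measurable D.
  have -> : D = \bigcup_k ([set u | best J u k] `&` loc k @^-1` A).
    by apply/seteqP; split=> u [k]; [exists k|move=> _ []; exists k].
  apply: bigcup_measurable => k _; apply: measurableI; first exact: measurable_best.
  exact: (measurable_preimage (measurable_loc k)).
pose F (m j : nat) := round_void (zone J (j%:R / m%:R)) `\` round_void (fun i =>
  zone A (j.+1%:R / m%:R) i `|` zone (J `\` A) (j%:R / m%:R) i).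
have slices (m : nat) : (0 < m)%N -> D `<=` \big[setU/set0]_(j < m) F m j.
  move=> m0 u [k [ak [Jk /andP[tk0 tk1]] hk] Ak].
  have m0' : (0 : R) < m%:R by rewrite ltr0n.
  pose j := Num.truncn (m%:R * tm k u : R).
  have /andP[j1 j2] : j%:R <= m%:R * tm k u < j.+1%:R by apply: truncn_itv; rewrite mulr_ge0.
  have jm : (j < m)%N.
    by rewrite -(ltr_nat R) (le_lt_trans j1)// -[ltRHS]mulr1 ltr_pM2l.
  rewrite -(bigcup_mkord m (F m)); exists j => //; split.
    apply/round_voidP => l al' [Jl /andP[tl0 tl1]].
    have tkl : tm l u < tm k u.
      by rewrite (lt_le_trans tl1)// ler_pdivrMr// mulrC.
    have zl : zone J 1 (unpair l).1 (src l u).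
      by split=> //; rewrite tl0/= (lt_trans tkl).
    have [h|[h _]] := hk l al' zl; first by have := lt_trans h tkl; rewrite ltxx.
    by move: tkl; rewrite h ltxx.
  move=> /round_voidP /(_ k ak); apply; left; split=> //.
  by rewrite tk0/= ltr_pdivlMr// mulrC.
set p := fine (U D).
have UD : U D = p%:E by rewrite fineK// fin_num_measure.
have p01 : 0 <= p <= 1 by rewrite -!lee_fin -UD measure_ge0 probability_le1.
rewrite UD lee_fin.
have key (m : nat) : (0 < m)%N ->
    p * (1 - expR (- (c / m%:R))) <= (1 - expR (- (al / m%:R))) * (1 - expR (- c)).
  move=> m0.
  have m0' : (0 : R) < m%:R by rewrite ltr0n.
  have c0' : expR (- (c / m%:R)) < 1 by rewrite expR_lt1 oppr_lt0 divr_gt0.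
  have x1 : 0 < 1 - expR (- (c / m%:R)) by rewrite subr_gt0.
  have xm : expR (- (c / m%:R)) ^+ m = expR (- c).
    by rewrite -expRM_natl mulrN mulrCA divff ?mulr1// gt_eqF.
  have pl : p <= \sum_(j < m) expR (- (c / m%:R)) ^+ j * (1 - expR (- (al / m%:R))).
    rewrite -lee_fin -UD.
    have mF j : measurable (F m j).
      apply: measurableD; apply: measurable_round_void => // i; last apply: measurableU;
        by apply: measurable_zone => //; exact: measurableD.
    apply: (@le_trans _ _ (\sum_(j < m) U (F m j))%E); last first.
      rewrite -sumEFin; apply: lee_sum => j _.
      by rewrite (race_slice mJ mA AJ hJ hA (ltn_ord j)).
    apply: (le_trans _ (@Boole_inequality _ _ _ U (F m) m _)) => //.
    by apply: le_measure; rewrite ?inE//; [exact: bigsetU_measurable|exact: slices].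
  rewrite -mulr_suml in pl.
  rewrite (le_trans (ler_wpM2r (ltW x1) pl))//.
  have geo : (1 - expR (- (c / m%:R))) * \sum_(j < m) expR (- (c / m%:R)) ^+ j =
      1 - expR (- c).
    by rewrite -[X in X * _]opprB mulNr -subrX1 xm opprB.
  by rewrite mulrAC [X in X * _]mulrC geo mulrC.
have B0 : 0 <= 1 - expR (- c) by rewrite subr_ge0 expR_le1 oppr_le0 ltW.
rewrite mulrAC ler_pdivlMr//.
apply/ler_addgt0Pr => e e0.
(* The discretization error for [m] slices is at most [c ^+ 2 / m]. *)
pose m := (Num.truncn (c ^+ 2 / e)).+1.
have m0 : (0 : R) < m%:R by rewrite ltr0n.
have me : c ^+ 2 / m%:R <= e.
  by rewrite ler_pdivrMr// mulrC -ler_pdivrMr// ltW// truncnS_gt.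
have km := key m isT.
set y := c / m%:R in km.
have y0 : 0 < y by rewrite divr_gt0.
have x1 : 1 - y <= expR (- y) by rewrite expR_ge1Dx.
have x2 : y * expR (- y) <= 1 - expR (- y).
  have h := expR_ge1Dx y.
  have : (1 + y) * expR (- y) <= expR y * expR (- y) by rewrite ler_pM2r ?expR_gt0.
  by rewrite -expRD subrr expR0; lra.
have x3 : 1 - expR (- (al / m%:R)) <= al / m%:R.
  by have := expR_ge1Dx (- (al / m%:R)); lra.
have [p0 p1] := andP p01.
have h1 : p * (y * (1 - y)) <= al / m%:R * (1 - expR (- c)).
  apply: le_trans (ler_wpM2r B0 x3); apply: le_trans km; apply: ler_wpM2l => //.
  by apply: le_trans x2; rewrite ler_pM2l.
have h2 : p * (c * (1 - y)) <= al * (1 - expR (- c)).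
  rewrite -(ler_pM2r (_ : 0 < m%:R^-1)) ?invr_gt0//.
  by rewrite mulrAC; move: h1; rewrite /y; nra.
have h3 : p * (c * y) <= e.
  apply: le_trans me; rewrite /y expr2 mulrA -[leRHS]mul1r.
  by apply: ler_wpM2r => //; rewrite divr_ge0// mulr_ge0// ltW.
by nra.
Qed.

End race.

(** * The first round with a point in the region *)

Section selection.
Context (R : realType).
Local Notation TR := (measurableTypeR R).
Variable U : probability TR R.
Hypothesis hU : uniform_law U.
Variables a b : TR -> TR.
Hypothesis ma : measurable_fun setT a.
Hypothesis mb : measurable_fun setT b.
Hypothesis ab : forall A B, measurable A -> measurable B ->
  U (a @^-1` A `&` b @^-1` B) = (U A * U B)%E.
Variable N : TR -> nat.
Hypothesis mN : measurable_fun setT N.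
Hypothesis N_law : forall n, U (N @^-1` [set n]) = (expR (- 1) / n`!%:R)%:E.
Context dE (E : measurableType dE).
Variable th : nat -> TR -> E.
Hypothesis mth : forall i, measurable_fun setT (th i).

Local Notation draw := (draw a b).
Local Notation cell_void := (cell_void a b N).
Local Notation round_void := (round_void a b N).
Local Notation src := (src a b).
Local Notation loc := (loc a b th).
Local Notation tm := (tm a b).
Local Notation active := (active a b N).
Local Notation zone := (zone a b th).
Local Notation best := (best a b N th).
Local Notation mass := (mass U th).

Definition good (J : set E) : set TR := [set u | exists k, best J u k].

Lemma measurable_good J : measurable J -> measurable (good J).
Proof.
move=> mJ; have -> : good J = \bigcup_k [set u | best J u k].
  by apply/seteqP; split=> u [k]; [exists k|move=> _ ?; exists k].
by apply: bigcup_measurable => k _; exact: measurable_best.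
Qed.

(** Only finitely many points are candidates, so an earliest one exists. *)
Lemma finite_best J u n : (forall i, (n <= i)%N -> cell_void (zone J 1 i) (draw i u)) ->
  ~ round_void (zone J 1) u -> good J u.
Proof.
move=> voidn nvoid.
pose cnd k := `[< active k u /\ zone J 1 (unpair k).1 (src k u) >].
pose M := \max_(i < n) N (draw 0 (draw i u)).
pose L := (\max_(i < n) \max_(m < M) pickle (i : nat, m : nat)).+1.
have bnd k : cnd k -> (k < L)%N.
  move=> /asboolP[/andP[/eqP kE kN] zk].
  have ltn : ((unpair k).1 < n)%N.
    by rewrite ltnNge; apply/negP => /voidn h; exact: h _ kN zk.
  have ltM : ((unpair k).2 < M)%N.
    apply: (leq_trans kN).
    exact: (leq_bigmax (F := fun i : 'I_n => N (draw 0 (draw i u))) (Ordinal ltn)).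
  rewrite ltnS -kE [unpair k]surjective_pairing.
  apply: leq_trans (leq_bigmax (F := fun i : 'I_n => \max_(m < M) pickle (i : nat, m : nat)) (Ordinal ltn)).
  exact: (leq_bigmax (F := fun m : 'I_M => pickle ((unpair k).1, m : nat)) (Ordinal ltM)).
have [k0 ck0] : exists k, cnd k.
  apply: contrapT => /forallNP h; apply: nvoid; apply/round_voidP => k ak zk.
  by apply: (h k); apply/asboolP.
have := @arg_minP _ R 'I_L (Ordinal (bnd _ ck0)) (fun k => cnd k) (fun k => tm k u : R) ck0.
case=> k1 ck1 k1min.
pose p k := cnd k && (tm k u == tm k1 u).
have [|/andP[/asboolP[a2 z2] /eqP t2] k2min] := @leastP p.
  by exists k1; rewrite /p ck1 eqxx.
exists (least p); split=> // l al zl.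
have cl : cnd l by apply/asboolP.
have := k1min (Ordinal (bnd _ cl)) cl; rewrite /= le_eqVlt => /orP[/eqP e|lt].
  by right; rewrite t2; split=> //; apply: k2min; rewrite /p cl e eqxx.
by left; rewrite t2.
Qed.

(** Borel-Cantelli: the masses of the cells are summable, so almost surely only
    finitely many cells have a point in the region. *)
Lemma no_best_null J c : measurable J -> mass J c ->
  U (~` round_void (zone J 1) `&` ~` good J) = 0%E.
Proof.
move=> mJ hJ.
pose H i := draw i @^-1` (~` cell_void (zone J 1 i)).
have mc i : measurable (cell_void (zone J 1 i)).
  by apply: measurable_cell_void => //; exact: measurable_zone.
have mH i : measurable (H i).
  by apply: (measurable_preimage (measurable_draw ma mb i)); exact: measurableC.
pose z i := fine (U (th i @^-1` J)).
have Hz i : (U (H i) <= (z i)%:E)%E.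
  rewrite (draw_law ma mb ab)//; last exact: measurableC.
  rewrite (probability_setC U (mc i)).
  rewrite (cell_void_law ma mb ab mN N_law (z := z i)); last 2 first.
  - exact: measurable_zone.
  - by rewrite (zone_law hU ab)// ?lexx ?ler01// mulr1.
  by rewrite -EFinB lee_fin; have := expR_ge1Dx (- z i); lra.
have z0 i : 0 <= z i by exact: fine_ge0.
have null : U (lim_sup_set H) = 0%E.
  apply: lim_sup_set_cvg0 => //.
  apply: (@le_lt_trans _ _ (\sum_(i <oo) (z i)%:E)%E).
    by apply: lee_nneseries => // i _; exact: Hz.
  rewrite (_ : limn _ = c%:E) ?ltry//; apply: cvg_lim => //.
  rewrite (_ : (fun n => _) = EFin \o (fun n => \sum_(i < n) z i)); last first.
    by apply/funext => n /=; rewrite sumEFin big_mkord.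
  by apply: cvg_EFin => //; exact: nearW.
have mlim : measurable (lim_sup_set H).
  by apply: bigcapT_measurable => n; apply: bigcup_measurable.
apply/eqP; rewrite eq_le measure_ge0 andbT -null; apply: le_measure; rewrite ?inE//.
  apply: measurableI; apply: measurableC; last exact: measurable_good.
  by apply: measurable_round_void => // i; exact: measurable_zone.
move=> u [nv ng]; apply: contrapT => nlim; apply: ng.
have [n nH] : exists n, forall j, (n <= j)%N -> ~ H j u.
  apply: contrapT => /forallNP h; apply: nlim => n _.
  apply: contrapT => hn; apply: (h n) => j nj Hj; apply: hn.
  by exists j.
apply: (@finite_best _ _ n) => // i ni; apply: contrapT => hi.
exact: (nH i ni).
Qed.

Lemma bad_le J c : measurable J -> mass J c -> (U (~` good J) <= (expR (- c))%:E)%E.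
Proof.
move=> mJ hJ; set V := round_void (zone J 1).
have mV : measurable V by apply: measurable_round_void => // i; exact: measurable_zone.
have mg := measurable_good mJ.
have -> : expR (- c) = expR (- (c * 1)) by rewrite mulr1.
rewrite -(void_law hU ma mb ab mN N_law mth mJ hJ); last by rewrite lexx ler01.
rewrite -/V -[leRHS]adde0 -(no_best_null mJ hJ).
apply: (@le_trans _ _ (U (V `|` (~` V `&` ~` good J)))).
  apply: le_measure; rewrite ?inE.
  - exact: measurableC.
  - by apply: measurableU => //; apply: measurableI; exact: measurableC.
  - by move=> u ng; have [|] := pselect (V u); [left|right].
by apply: measureU2 => //; apply: measurableI; exact: measurableC.
Qed.

(** Decomposition at the first round, of source [a u]: either it settles [D]
    (the event [Q]), or it is inconclusive (the event [V]) and the question is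
    the same for the other rounds, of source [b u].  The probability [p] of [D]
    thus satisfies [p <= q * (1 - e) + e * p]. *)
Lemma contraction (D Q V : set TR) (e q : R) :
  measurable D -> measurable Q -> measurable V ->
  (U Q <= (q * (1 - e))%:E)%E -> (U V <= e%:E)%E -> e < 1 ->
  D `<=` a @^-1` Q `|` (a @^-1` V `&` b @^-1` D) -> (U D <= q%:E)%E.
Proof.
move=> mD mQ mV Qq Ve e1 DQ.
have h : (U D <= U Q + U V * U D)%E.
  have mQ' := measurable_preimage ma mQ.
  have mV' := measurableI _ _ (measurable_preimage ma mV) (measurable_preimage mb mD).
  rewrite -(fst_law ab mQ) -(ab mV mD).
  apply: le_trans (measureU2 U mQ' mV').
  by apply: le_measure; rewrite ?inE//; exact: measurableU.
move: h Qq Ve.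
rewrite -[U D]fineK ?fin_num_measure// -[U Q]fineK ?fin_num_measure//.
rewrite -[U V]fineK ?fin_num_measure// -EFinM -EFinD !lee_fin.
have := fine_ge0 (measure_ge0 U D).
set x := fine _; set y := fine _; set w := fine _ => x0 h hy hw.
have : x * (1 - e) <= q * (1 - e) by nra.
by rewrite ler_pM2r// subr_gt0.
Qed.

(** Round [r] has the source [draw r u].  The selected location is that of the
    earliest point of [J] in the first round that has one. *)
Definition ever (J : set E) : set TR := [set u | exists r, good J (draw r u)].
Definition frst J u : nat := least (fun r => `[< good J (draw r u) >]).
Definition pick J u : nat := least (fun k => `[< best J u k >]).
Definition sel J u : E :=
  loc (pick J (draw (frst J u) u)) (draw (frst J u) u).

Lemma measurable_ever J : measurable J -> measurable (ever J).
Proof.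
move=> mJ; have -> : ever J = \bigcup_r draw r @^-1` good J.
  by apply/seteqP; split=> u [r]; [exists r|move=> _ ?; exists r].
apply: bigcup_measurable => r _.
exact: (measurable_preimage (measurable_draw ma mb r) (measurable_good mJ)).
Qed.

Lemma measurable_asbool d (T : measurableType d) (P : T -> Prop) :
  measurable [set x | P x] -> measurable_fun setT (fun x => `[< P x >]).
Proof.
move=> mP; apply: (measurable_fun_bool true); rewrite setTI.
by rewrite (_ : _ @^-1` _ = [set x | P x])//; apply/seteqP; split=> x /= /asboolP.
Qed.

Lemma measurable_sel J : measurable J -> measurable_fun setT (sel J).
Proof.
move=> mJ.
have mpick : measurable_fun setT (pick J).
  by apply: measurable_least => k; apply: measurable_asbool; exact: measurable_best.
have mfrst : measurable_fun setT (frst J).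
  apply: measurable_least => r; apply: measurable_asbool.
  exact: (measurable_preimage (measurable_draw ma mb r) (measurable_good mJ)).
have mchosen : measurable_fun setT (fun v => loc (pick J v) v).
  by apply: (measurable_nat_fun (g := loc)) => // k; exact: measurable_loc.
apply: (measurable_nat_fun (f := frst J)
  (g := fun r u => loc (pick J (draw r u)) (draw r u))) => // r.
exact: (measurableT_comp mchosen (measurable_draw ma mb r)).
Qed.

Lemma sel0 J u k : best J (a u) k -> sel J u = loc k (a u).
Proof.
move=> bk; have f0 : frst J u = 0%N.
  by apply: least_eq => //; apply/asboolP; exists k.
rewrite /sel f0 (_ : pick J (draw 0 u) = k)//.
have [|/asboolP bl _] := @leastP (fun k => `[< best J (a u) k >]).
  by exists k; apply/asboolP.
exact: best_unique bl bk.
Qed.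

Lemma selS J u : ~ good J (a u) -> ever J u -> ever J (b u) /\ sel J u = sel J (b u).
Proof.
move=> ng [[|r] gr]; first by [].
have evb : ever J (b u) by exists r; rewrite -drawS.
split=> //; have [|/asboolP gl lmin] := @leastP (fun r => `[< good J (draw r (b u)) >]).
  by case: evb => r' gr'; exists r'; apply/asboolP.
have f1 : frst J u = (frst J (b u)).+1.
  apply: least_eq; first by apply/asboolP; rewrite drawS.
  move=> [_|j jl]; first exact/asboolP.
  apply/negP; rewrite drawS => /lmin; rewrite leqNgt; apply/negP/negPn.
  exact: jl.
by rewrite /sel f1 drawS.
Qed.

Lemma ever1 J c : measurable J -> mass J c -> 0 < c -> U (ever J) = 1%E.
Proof.
move=> mJ hJ c0; have mev := measurable_ever mJ.
suff : (U (~` ever J) <= 0%:E)%E.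
  rewrite (probability_setC U mev) -[U (ever J)]fineK ?fin_num_measure//.
  have := probability_le1 U mev; rewrite -[U (ever J)]fineK ?fin_num_measure//.
  by rewrite -EFinB !lee_fin => h1 h2; congr EFin; apply/eqP; rewrite eq_le h1/=; lra.
apply: (@contraction _ set0 (~` good J) (expR (- c))) => //.
- exact: measurableC.
- by apply: measurableC; exact: measurable_good.
- by rewrite measure0 mul0r.
- exact: bad_le.
- by rewrite expR_lt1 oppr_lt0.
- move=> u nev; right; split=> /= [g|[r gr]]; apply: nev; first by exists 0%N.
  by exists r.+1; rewrite drawS.
Qed.

Lemma sel_law_le J A c al : measurable J -> measurable A -> A `<=` J ->
  mass J c -> mass A al -> 0 < c ->
  (U (ever J `&` sel J @^-1` A) <= (al / c)%:E)%E.
Proof.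
move=> mJ mA AJ hJ hA c0.
pose Q := [set u | exists2 k, best J u k & A (loc k u)].
have mQ : measurable Q.
  have -> : Q = \bigcup_k ([set u | best J u k] `&` loc k @^-1` A).
    by apply/seteqP; split=> u [k]; [exists k|move=> _ []; exists k].
  apply: bigcup_measurable => k _; apply: measurableI; first exact: measurable_best.
  exact: (measurable_preimage (measurable_loc ma mb mth k)).
apply: (@contraction _ Q (~` good J) (expR (- c))) => //.
- apply: measurableI; first exact: measurable_ever.
  exact: (measurable_preimage (measurable_sel mJ)).
- by apply: measurableC; exact: measurable_good.
- exact: race_bound.
- exact: bad_le.
- by rewrite expR_lt1 oppr_lt0.
move=> u [ev Au]; have [[k bk]|ng] := pselect (good J (a u)).
  by left; exists k => //; move: Au; rewrite /= (sel0 bk).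
have [evb selb] := selS ng ev.
by right; split=> //; split=> //; move: Au; rewrite /= selb.
Qed.

Lemma void_bad J K u : K `<=` J -> round_void (zone J 1) u -> ~ good K u.
Proof.
move=> KJ /round_voidP h [k [ak [Kk tk] _]]; apply: (h k ak); split => //.
exact: KJ.
Qed.

(** While no point of the union of [K] and [L] has arrived both selections wait.
    If the earliest point of the union is in both regions it is the earliest
    point of each, and both select it; so they can only differ when it is in the
    symmetric difference, which [race_bound] controls.  Selections are compared
    through [f], which forgets the auxiliary coordinate of a location. *)
Lemma sel_diff_le (Y : Type) (f : E -> Y) K L c de :
  measurable K -> measurable L ->
  mass (K `|` L) c -> mass ((K `\` L) `|` (L `\` K)) de -> 0 < c ->
  (exists2 k, mass K k & 0 < k) -> (exists2 l, mass L l & 0 < l) ->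
  measurable [set u | f (sel K u) <> f (sel L u)] ->
  (U [set u | f (sel K u) <> f (sel L u)] <= (de / c)%:E)%E.
Proof.
move=> mK mL hJ hD c0 [k hK k0] [l hL l0] mS.
set S := [set u | _] in mS *.
pose J := K `|` L; pose A := (K `\` L) `|` (L `\` K).
have mJ : measurable J by exact: measurableU.
have mA : measurable A by apply: measurableU; exact: measurableD.
have AJ : A `<=` J by move=> x [[]|[]]; [left|right].
pose Q := [set u | exists2 k, best J u k & A (loc k u)].
have mQ : measurable Q.
  have -> : Q = \bigcup_k ([set u | best J u k] `&` loc k @^-1` A).
    by apply/seteqP; split=> u [i]; [exists i|move=> _ []; exists i].
  apply: bigcup_measurable => i _; apply: measurableI; first exact: measurable_best.
  exact: (measurable_preimage (measurable_loc ma mb mth i)).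
pose V := round_void (zone J 1).
have mV : measurable V by apply: measurable_round_void => // i; exact: measurable_zone.
(* The null event that [J] has points in the round but no earliest one. *)
pose O := ~` V `&` ~` good J.
have mO : measurable O.
  by apply: measurableI; apply: measurableC => //; exact: measurable_good.
have mev : measurable (ever K `&` ever L) by apply: measurableI; exact: measurable_ever.
have ev1 : U (ever K `&` ever L) = 1%E.
  by rewrite probability_setI1; [exact: ever1 hK k0|exact: measurable_ever|exact: measurable_ever|exact: ever1 hL l0].
rewrite -(probability_setI1 mS mev ev1).
apply: (@contraction _ (Q `|` O) V (expR (- c))) => //.
- exact: measurableI.
- exact: measurableU.
- apply: le_trans (measureU2 U mQ mO) _.
  rewrite [X in (_ + X)%E](no_best_null mJ hJ) adde0.
  exact: race_bound.
- rewrite (void_law hU ma mb ab mN N_law mth mJ hJ); last by rewrite lexx ler01.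
  by rewrite mulr1.
- by rewrite expR_lt1 oppr_lt0.
move=> u [Su [evK evL]].
have [Vu|nV] := pselect (V (a u)).
  have gK : ~ good K (a u) by apply: (void_bad _ Vu) => x; left.
  have gL : ~ good L (a u) by apply: (void_bad _ Vu) => x; right.
  have [eK sK] := selS gK evK; have [eL sL] := selS gL evL.
  by right; split=> //; split=> //; move: Su; rewrite /S/= sK sL.
left; have [[i bi]|ng] := pselect (good J (a u)); last by right.
left; exists i => //.
have Ji : J (loc i (a u)) by case: bi => _ [].
have bK : K (loc i (a u)) -> best K (a u) i by apply: best_sub bi => x; left.
have bL : L (loc i (a u)) -> best L (a u) i by apply: best_sub bi => x; right.
have [Ki|nK] := pselect (K (loc i (a u))); last by right; case: Ji.
have [Li|nL] := pselect (L (loc i (a u))); last by left.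
by exfalso; apply: Su; rewrite (sel0 (bK Ki)) (sel0 (bL Li)).
Qed.

End selection.

(** * Regions under densities *)

Section density.
Context (R : realType).
Local Notation TR := (measurableTypeR R).
Variable U : probability TR R.
Hypothesis hU : uniform_law U.
Variables a b : TR -> TR.
Hypothesis ma : measurable_fun setT a.
Hypothesis mb : measurable_fun setT b.
Hypothesis ab : forall A B, measurable A -> measurable B ->
  U (a @^-1` A `&` b @^-1` B) = (U A * U B)%E.
Context dT (T : measurableType dT).
Variable nu : probability T R.
Variable psi : TR -> T.
Hypothesis mpsi : measurable_fun setT psi.
Hypothesis psiE : forall A, measurable A -> U (psi @^-1` A) = nu A.

Lemma joint_law S : measurable S -> U [set v | S (psi (a v), b v)] = (nu \x U)%E S.
Proof.
move=> mS.
have mf : measurable_fun setT (fun v => (psi (a v), b v)).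
  by apply: measurable_fun_pair => //; exact: measurableT_comp.
rewrite (product_measure_unique (m' := distribution U (mfun_of mf)))//.
move=> A B mA mB.
transitivity (U (psi @^-1` A) * U B)%E; last by congr (_ * _)%E; exact: psiE.
by rewrite -(ab (measurable_preimage mpsi mA) mB).
Qed.

(** The locations of cell [i] are in the strip of heights between [i] and [i.+1],
    where their law is [nu] times Lebesgue measure. *)
Definition cell (i : nat) (v : TR) : (T * TR)%type := (psi (a v), i%:R + b v).

Lemma measurable_cell i : measurable_fun setT (cell i).
Proof.
apply: measurable_fun_pair; first exact: measurableT_comp.
exact: measurable_funD.
Qed.

Definition subgraph (f : T -> R) : set (T * TR)%type := [set p | 0 <= p.2 < f p.1].

Lemma measurable_subgraph f : measurable_fun setT f -> measurable (subgraph f).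
Proof.
move=> mf.
have -> : subgraph f = [set p | 0 <= p.2] `&` [set p | p.2 < f p.1].
  by apply/seteqP; split=> p /= => [/andP[]//|[h1 h2]]; apply/andP.
apply: measurableI.
  have := @measurable_fun_ler _ (T * TR)%type R setT (fun=> 0) snd.
  by move=> /(_ _ _ measurableT [set true] Logic.I); rewrite setTI; apply => //; exact: measurable_snd.
have := @measurable_fun_ltr _ (T * TR)%type R setT snd (fun p => f p.1).
move=> /(_ _ _ measurableT [set true] Logic.I); rewrite setTI; apply.
  exact: measurable_snd.
by apply: (measurableT_comp mf); exact: measurable_fst.
Qed.

(** The length of the part below height [t] of a strip of height one. *)
Definition clip (t : R) : R := Num.max 0 (Num.min 1 t).

Lemma clip_sum (t : R) n : 0 <= t -> \sum_(i < n) clip (t - i%:R) = Num.min t n%:R.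
Proof.
move=> t0; elim: n => [|n IH]; first by rewrite big_ord0 /Num.min; case: ltgtP t0.
rewrite big_ord_recr/= IH /clip -natr1.
have [h|h] := lerP t n%:R.
  by rewrite (min_r (_ : t - n%:R <= 1)) ?max_l ?min_l ?addr0//; lra.
have [h'|h'] := lerP t (n%:R + 1).
  by rewrite (min_r (_ : t - n%:R <= 1)) ?max_r ?subrKC//; lra.
by rewrite (min_l (_ : 1 <= t - n%:R)) ?max_r//; lra.
Qed.

Lemma measurable_clip (f : T -> R) (i : nat) : measurable_fun setT f ->
  measurable_fun setT (fun x : T => clip (f x - i%:R)).
Proof.
move=> mf; apply: measurable_maxr => //; apply: measurable_minr => //.
exact: measurable_funB.
Qed.

Lemma clip_law (t : R) (i : nat) : U [set y | 0 <= i%:R + y < t] = (clip (t - i%:R))%:E.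
Proof.
have m01 : U `[0, 1]%classic = 1%E by exact: uniform01.
have -> : [set y | 0 <= i%:R + y < t] = `[- i%:R, t - i%:R[%classic.
  by apply/seteqP; split=> y /=; rewrite in_itv/=; lra.
rewrite -(probability_setI1 _ _ m01)//.
have i0 : (0 : R) <= i%:R by [].
set s := t - i%:R; rewrite /clip.
have [s1|s1] := ltP 1 s.
  rewrite max_r// (_ : _ `&` _ = `[0, 1]%classic)//.
  by apply/seteqP; split=> y /=; rewrite !in_itv/=; lra.
have [s0|s0] := ltP 0 s.
  rewrite (_ : _ `&` _ = `[0, s[%classic) ?hU ?subr0//; first exact: ltW.
  by apply/seteqP; split=> y /=; rewrite !in_itv/=; lra.
rewrite (_ : _ `&` _ = set0) ?measure0//.
by rewrite -subset0 => y [/=]; rewrite !in_itv/=; lra.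
Qed.

Lemma cell_law (f : T -> R) A i : measurable_fun setT f -> measurable A ->
  U (cell i @^-1` (subgraph f `&` fst @^-1` A)) =
  (\int[nu]_(x in A) (clip (f x - i%:R))%:E)%E.
Proof.
move=> mf mA.
pose S : set (T * TR)%type := [set p | A p.1 /\ 0 <= i%:R + p.2 < f p.1].
have mS : measurable S.
  have ms : measurable_fun setT (fun p : (T * TR)%type => (p.1, i%:R + p.2 : TR)).
    apply: measurable_fun_pair; first exact: measurable_fst.
    by apply: measurable_funD => //; exact: measurable_snd.
  have := measurable_preimage ms (measurable_subgraph mf).
  have := measurable_preimage (@measurable_fst _ _ T TR) mA.
  move=> h1 h2; have := measurableI _ _ h1 h2; congr measurable.
have -> : cell i @^-1` (subgraph f `&` fst @^-1` A) = [set v | S (psi (a v), b v)].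
  by apply/seteqP; split=> v [].
rewrite joint_law// /product_measure1 [RHS]integral_mkcond.
apply: eq_integral => x _; rewrite patchE.
case: ifPn => xA.
  rewrite -clip_law /=; congr (U _).
  by apply/seteqP; split=> y; rewrite /xsection/= !inE /S/=; [move=> []|move: xA; rewrite inE].
rewrite /= (_ : xsection S x = set0) ?measure0//.
rewrite -subset0 => y; rewrite /xsection/= inE => -[Ax _].
by move: xA; rewrite notin_setE.
Qed.

(** The first [n] strips see the density truncated at height [n]; the truncated
    integrals increase to the integral. *)
Lemma mass_subgraph (f : T -> R) A (p : R) : measurable_fun setT f -> (forall x, 0 <= f x) ->
  measurable A -> (\int[nu]_(x in A) (f x)%:E)%E = p%:E ->
  mass U cell (subgraph f `&` fst @^-1` A) p.
Proof.
move=> mf f0 mA fp; rewrite /mass.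
have mmin n : measurable_fun setT (fun x => Num.min (f x) n%:R).
  exact: measurable_minr.
have E n : (\sum_(i < n) fine (U (cell i @^-1` (subgraph f `&` fst @^-1` A))))%:E =
    (\int[nu]_(x in A) (Num.min (f x) n%:R)%:E)%E.
  have cE i : (fine (U (cell i @^-1` (subgraph f `&` fst @^-1` A))))%:E =
      (\int[nu]_(x in A) (clip (f x - i%:R))%:E)%E.
    rewrite fineK; first exact: cell_law.
    apply: fin_num_measure; apply: (measurable_preimage (measurable_cell i)).
    apply: measurableI; first exact: measurable_subgraph.
    exact: (measurable_preimage (@measurable_fst _ _ T TR) mA).
  rewrite -sumEFin; under eq_bigr do rewrite cE.
  rewrite -ge0_integral_sum//.
  - by apply: eq_integral => x _; rewrite sumEFin clip_sum.
  - by move=> i; apply/measurable_funTS/measurable_EFinP; exact: measurable_clip.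
  - by move=> i x _; rewrite lee_fin /clip le_max lexx.
have cv : (fun n => (\int[nu]_(x in A) (Num.min (f x) n%:R)%:E)%E) @ \oo --> p%:E.
  rewrite -fp (_ : (\int[nu]_(x in A) (f x)%:E)%E =
     (\int[nu]_(x in A) limn (fun n => (Num.min (f x) n%:R)%:E))%E).
    apply: cvg_monotone_convergence => //.
    - by move=> n; apply/measurable_funTS/measurable_EFinP; exact: mmin.
    - by move=> n x _; rewrite lee_fin le_min f0/=.
    - move=> x _ m n mn; rewrite lee_fin le_min ge_min lexx/= ge_min ler_nat mn orbT.
      by [].
  apply: eq_integral => x _; apply/esym/cvg_lim => //.
  apply: (@cvg_trans _ ((fun=> (f x)%:E) @ \oo)); last exact: cvg_cst.
  apply: near_eq_cvg; near=> n; congr EFin.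
  rewrite min_l//; near: n; exact: nbhs_infty_ger.
move/fine_cvg : cv; apply: cvg_trans; apply: near_eq_cvg; apply: nearW => n /=.
by rewrite -E.
Unshelve. all: by end_near. Qed.

End density.

(** * An equivalent probability and a Poisson variable *)

Section equivalent_probability.
Context d (T : measurableType d) (R : realType).

Lemma nneseries_eq0 (u : nat -> \bar R) : (forall n, 0 <= u n)%E ->
  (\sum_(n <oo) u n)%E = 0%E -> forall n, u n = 0%E.
Proof.
move=> u0 su n; apply/eqP; rewrite eq_le u0 andbT -su.
rewrite (le_trans _ (nneseries_lim_ge n.+1 _))//.
by rewrite big_nat_recr//= leeDr// sume_ge0.
Qed.

(** A weighted sum of the restrictions of [mu] to countably many sets of finite
    measure that cover the space, normalized.  The weights make the sum at most
    1. *)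
Lemma equivalent_probability (mu : {sigma_finite_measure set T -> \bar R}) :
  mu setT != 0%E -> exists nu : probability T R,
    forall A, measurable A -> nu A = 0%E <-> mu A = 0%E.
Proof.
move=> muT; have [F UF mFoo] := sigma_finiteT mu.
have mF k : measurable (F k) by have [] := mFoo k.
have Foo k : (mu (F k) < +oo)%E by have [] := mFoo k.
have w0 k : 0 < 2^-1 ^+ k.+1 / (1 + fine (mu (F k))).
  by rewrite divr_gt0// ?exprn_gt0// ltr_pwDl// fine_ge0.
pose w k : {nonneg R} := NngNum (ltW (w0 k)).
pose m k : {measure set T -> \bar R} := mscale (w k) (mrestr mu (mF k)).
pose nu0 : {measure set T -> \bar R} := mseries m 0.
have nu0E A : nu0 A = (\sum_(k <oo) (w k)%:num%:E * mu (A `&` F k))%E by [].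
have null A : measurable A -> nu0 A = 0%E <-> mu A = 0%E.
  move=> mA; rewrite nu0E; split=> [h|muA].
    have AFk k : mu (A `&` F k) = 0%E.
      have t0 j : (0 <= (w j)%:num%:E * mu (A `&` F j))%E by rewrite mule_ge0.
      have /eqP := nneseries_eq0 t0 h k.
      by rewrite mule_eq0 eqe gt_eqF//= => /eqP.
    apply/eqP; rewrite eq_le measure_ge0 andbT.
    have {1}-> : A = \bigcup_k (A `&` F k) by rewrite -setI_bigcupr -UF setIT.
    have mAF k : measurable (A `&` F k) by exact: measurableI.
    apply: le_trans (generalized_Boole_inequality mu mAF _) _.
      exact: bigcup_measurable.
    by rewrite le_eqVlt; apply/orP; left; apply/eqP/eseries0 => k _ _; exact: AFk.
  apply: eseries0 => k _ _; rewrite (_ : mu _ = 0%E) ?mule0//.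
  by apply/eqP; rewrite eq_le measure_ge0 andbT -muA; apply: le_measure; rewrite ?inE//; exact: measurableI.
have nu0T : nu0 setT != 0%E.
  by apply/eqP => /null h; move/eqP: muT; apply; exact: h.
have nu0oo : (nu0 setT < +oo)%E.
  apply: (@le_lt_trans _ _ (\sum_(k <oo) (2^-1 ^+ k.+1)%:E)%E).
    rewrite nu0E; apply: lee_nneseries => k _.
      by rewrite mule_ge0// lee_fin.
    rewrite setTI -[mu (F k)]fineK ?ge0_fin_numE// -EFinM lee_fin /=.
    rewrite mulrAC ler_pdivrMr ?ler_pM2l ?exprn_gt0//; first by rewrite lerDr.
    by rewrite ltr_pwDl// fine_ge0.
  rewrite (_ : limn _ = 1%:E) ?ltry//; apply: cvg_lim => //.
  have E n : (\sum_(0 <= k < n) (2^-1 ^+ k.+1 : R)%:E)%E = (1 - 2^-1 ^+ n)%:E.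
    elim: n => [|n IH]; first by rewrite big_nil expr0 subrr.
    by rewrite big_nat_recr//= IH -EFinD; congr EFin; rewrite exprS; lra.
  rewrite (funext E); apply: cvg_EFin; first exact: nearW.
  rewrite -[X in _ --> X]subr0; apply: cvgB; first exact: cvg_cst.
  by apply: cvg_expr; rewrite ger0_norm; lra.
exists (mnormalize nu0 \d_(point : T)) => A mA.
rewrite /= /mnormalize (negbTE nu0T) (lt_eqF nu0oo)/=.
rewrite -null//; split=> [/eqP|->]; last by rewrite mul0e.
rewrite mule_eq0 eqe invr_eq0 => /orP[/eqP//|].
have : nu0 setT \is a fin_num by rewrite ge0_fin_numE.
by move=> fin; rewrite fine_eq0// (negbTE nu0T).
Qed.

End equivalent_probability.

Section poisson_count.
Context (R : realType).
Local Notation TR := (measurableTypeR R).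
Variable U : probability TR R.
Hypothesis hU : uniform_law U.

Lemma poisson_count : exists N : TR -> nat, measurable_fun setT N /\
  forall n, U (N @^-1` [set n]) = (expR (- 1) / n`!%:R)%:E.
Proof.
pose i (n : nat) : TR := n%:R.
pose s (y : TR) : nat := Num.truncn (y : R).
have mi : measurable_fun setT i by move=> _ A mA.
have mle n : measurable [set y : TR | (s y <= n)%N].
  rewrite (_ : [set y | _] = `]-oo, n.+1%:R[%classic); first exact: measurable_itv.
  by apply/seteqP; split=> y /=; rewrite in_itv/= /s real_truncn_le_nat// num_real.
have ms : measurable_fun setT s.
  apply: measurable_nat => -[|n].
    rewrite (_ : _ @^-1` _ = [set y | (s y <= 0)%N])//.
    by apply/seteqP; split=> y /=; rewrite leqn0 => /eqP.
  rewrite (_ : _ @^-1` _ = [set y | (s y <= n.+1)%N] `\` [set y | (s y <= n)%N]).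
    exact: measurableD.
  apply/seteqP; split=> y /= => [->|[h1 /negP]]; first by rewrite leqnn ltnn.
  by rewrite -ltnNge => h2; apply/eqP; rewrite eqn_leq h1.
have [N [mN NE]] := realize (k := poisson_prob (1 : R) 0) hU mi ms measurableT
  (probability_setT _) (fun n _ => natrK n).
exists N; split=> // n.
rewrite NE// /= /poisson_prob ltr01 esum_set1; last by rewrite lee_fin poisson_pmf_ge0.
by rewrite /poisson_pmf ltr01 expr1n mul1r mulrC.
Qed.

End poisson_count.

(** * The Poisson coupling *)

Section poisson_coupling.
Context (R : realType).
Local Notation TR := (measurableTypeR R).
Context dT (T : measurableType dT).
Variables (i : T -> TR) (s : TR -> T).
Hypothesis mi : measurable_fun setT i.
Hypothesis ms : measurable_fun setT s.
Hypothesis is_ : cancel i s.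

(** Two points differ iff their images in the line differ, and the diagonal of
    the plane is Borel. *)
Lemma measurable_neq d (S : measurableType d) (g h : S -> T) :
  measurable_fun setT g -> measurable_fun setT h -> measurable [set u | g u <> h u].
Proof.
move=> mg mh.
have := @measurable_fun_eqr _ S R setT _ _ (measurableT_comp mi mg) (measurableT_comp mi mh).
move=> /(_ measurableT [set false] Logic.I); rewrite setTI.
rewrite (_ : _ @^-1` _ = [set u | g u <> h u])//.
apply/seteqP; split=> u /=; first by move=> /eqP + gh; rewrite gh; apply.
by move=> gh; apply/eqP => /(can_inj is_).
Qed.

Variable U : probability TR R.
Hypothesis hU : uniform_law U.

Lemma realize_law (k : probability T R) : exists psi : TR -> T,
  measurable_fun setT psi /\ forall A, measurable A -> U (psi @^-1` A) = k A.
Proof.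
by apply: (realize hU mi ms measurableT (probability_setT k)) => x _; exact: is_.
Qed.

Lemma density (nu P : probability T R) : P `<< nu -> exists f : T -> R,
  [/\ measurable_fun setT f, forall x, 0 <= f x &
   forall A, measurable A -> (\int[nu]_(x in A) (f x)%:E)%E = P A].
Proof.
move=> /radon_nikodym_sigma_finite [f [f0 ffin fint fE]].
exists (fine \o f); split.
- by apply: measurableT_comp => //; exact: measurable_int fint.
- by move=> x; exact: fine_ge0.
- by move=> A mA; rewrite fE//; apply: eq_integral => x _; rewrite /= fineK.
Qed.

Lemma sel_in dE (E : measurableType dE) a b N (th : nat -> TR -> E) J u :
  ever a b N th J u -> J (sel a b N th J u).
Proof.
move=> [r gr]; rewrite /sel.
have [|/asboolP[k bk] _] := @leastP (fun r => `[< good a b N th J (draw a b r u) >]).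
  by exists r; apply/asboolP.
set v := draw a b _ u in bk *.
have [|/asboolP[_ [Jv _] _] _] := @leastP (fun k => `[< best a b N th J v k >]).
  by exists k; apply/asboolP.
exact: Jv.
Qed.

(** [V P] is the first coordinate of the location selected in the region [K P]
    under the density [g P].  The part of [K P] above [A] has mass [P A], which
    bounds the law of [V P] by [P]; as both are probabilities, the bound for the
    complement of [A] gives equality.  With [D] the set where [g Q < g P], both
    differences of the regions have mass [de = P D - Q D], and [sel_diff_le]
    gives [2 * de / (1 + de)]. *)
Lemma poisson_coupling (nu : probability T R) :
  exists V : probability T R -> TR -> T,
  [/\ forall P : probability T R, P `<< nu -> measurable_fun setT (V P),
      forall (P : probability T R) A, P `<< nu -> measurable A -> U (V P @^-1` A) = P A &
      forall P Q : probability T R, P `<< nu -> Q `<< nu -> exists2 D, measurable D &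
        (U [set u | V P u <> V Q u] <= 2%:E * (P D - Q D))%E].
Proof.
have [a [b [ma mb ab]]] := split_uniform hU.
have [N [mN N_law]] := poisson_count hU.
have [psi [mpsi psiE]] := realize_law nu.
have /choice[g gP] : forall P : probability T R, exists f : T -> R, P `<< nu ->
  [/\ measurable_fun setT f, forall x, 0 <= f x &
   forall A, measurable A -> (\int[nu]_(x in A) (f x)%:E)%E = P A].
  move=> P; have [/density[f fP]|nac] := pselect (P `<< nu); first by exists f.
  by exists (fun=> 0).
pose th := cell a b psi.
have mth j : measurable_fun setT (th j) by exact: measurable_cell.
pose K P := subgraph (g P).
have mK (P : probability T R) : P `<< nu -> measurable (K P).
  by move=> /gP[mg _ _]; exact: measurable_subgraph.
have massK (P : probability T R) A : P `<< nu -> measurable A ->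
    mass U th (K P `&` fst @^-1` A) (fine (P A)).
  move=> /gP[mg g0 gE] mA; apply: (mass_subgraph hU ma mb ab mpsi psiE) => //.
  by rewrite gE// fineK// fin_num_measure.
have massK1 (P : probability T R) : P `<< nu -> mass U th (K P) 1.
  move=> Pnu; have := massK P setT Pnu measurableT.
  by rewrite preimage_setT setIT probability_setT.
pose V P u := (sel a b N th (K P) u).1.
have mV (P : probability T R) : P `<< nu -> measurable_fun setT (V P).
  move=> Pnu; apply: (measurableT_comp (@measurable_fst _ _ T TR)).
  exact: (measurable_sel ma mb mN mth (mK P Pnu)).
have le1 (P : probability T R) A : P `<< nu -> measurable A -> (U (V P @^-1` A) <= P A)%E.
  move=> Pnu mA.
  have mfA : measurable (fst @^-1` A : set (T * TR)).
    exact: (measurable_preimage (@measurable_fst _ _ T TR) mA).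
  have mKA : measurable (K P `&` fst @^-1` A) by apply: measurableI => //; exact: mK.
  have mev := measurable_ever ma mb mN mth (mK P Pnu).
  have ev1 := ever1 hU ma mb ab mN N_law mth (mK P Pnu) (massK1 P Pnu) ltr01.
  have mVA := measurable_preimage (mV P Pnu) mA.
  rewrite -(probability_setI1 mVA mev ev1).
  have := sel_law_le hU ma mb ab mN N_law mth (mK P Pnu) mKA (@subIsetl _ _ _)
    (massK1 P Pnu) (massK P A Pnu mA) ltr01.
  rewrite divr1 fineK ?fin_num_measure//; apply: le_trans.
  apply: le_measure; rewrite ?inE.
  - exact: measurableI.
  - apply: measurableI => //.
    exact: (measurable_preimage (measurable_sel ma mb mN mth (mK P Pnu))).
  - by move=> u [VA ev]; split=> //; split=> //; exact: sel_in.
exists V; split=> [//|P A Pnu mA|P Q Pnu Qnu].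
  have mVA := measurable_preimage (mV P Pnu) mA.
  apply/eqP; rewrite eq_le le1//=.
  have := le1 P (~` A) Pnu (measurableC mA).
  rewrite preimage_setC (probability_setC U mVA) (probability_setC P mA).
  rewrite -[U _]fineK ?fin_num_measure// -[P A]fineK ?fin_num_measure//.
  by rewrite -!EFinB !lee_fin; lra.
have [mgP g0P _] := gP P Pnu; have [mgQ g0Q _] := gP Q Qnu.
pose D : set T := [set x | g Q x < g P x].
have mD : measurable D.
  have := @measurable_fun_ltr _ T R setT _ _ mgQ mgP.
  by move=> /(_ measurableT [set true] Logic.I); rewrite setTI; exact.
exists D => //.
have mfA A : measurable A -> measurable (fst @^-1` A : set (T * TR)).
  by move=> mA; exact: (measurable_preimage (@measurable_fst _ _ T TR) mA).
pose de := fine (P D) - fine (Q D).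
have massPQ : mass U th (K P `\` K Q) de.
  have -> : K P `\` K Q = (K P `&` fst @^-1` D) `\` (K Q `&` fst @^-1` D).
    apply/seteqP; split=> p /=; rewrite /K /subgraph /D /=.
      move=> [/andP[p0 pP] nQ]; have gQ : g Q p.1 <= p.2.
        by rewrite leNgt; apply/negP => h; apply: nQ; rewrite p0.
      by split=> [|[]//]; rewrite p0 pP; split=> //; exact: le_lt_trans pP.
    by move=> [[h1 h2] h3]; split=> // h4; apply: h3.
  apply: massD => //; try (by apply: measurableI; [exact: mK|exact: mfA]);
    try exact: massK.
  move=> p [/andP[p0 pQ] Dp]; split=> //; rewrite /K /subgraph /=.
  by rewrite p0 (lt_trans pQ).
have massQP : mass U th (K Q `\` K P) de.
  have -> : de = fine (Q (~` D)) - fine (P (~` D)).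
    rewrite (probability_setC P mD) (probability_setC Q mD) !fineB ?fin_num_measure//=.
    by rewrite /de; lra.
  have -> : K Q `\` K P = (K Q `&` fst @^-1` (~` D)) `\` (K P `&` fst @^-1` (~` D)).
    apply/seteqP; split=> p /=; rewrite /K /subgraph /D /=.
      move=> [/andP[p0 pQ] nP]; have gP' : g P p.1 <= p.2.
        by rewrite leNgt; apply/negP => h; apply: nP; rewrite p0.
      split=> [|[]//]; rewrite p0 pQ; split=> //; apply/negP; rewrite -leNgt.
      exact: le_trans gP' (ltW pQ).
    by move=> [[h1 h2] h3]; split=> // h4; apply: h3.
  have mDC := measurableC mD.
  apply: massD => //; try (by apply: measurableI; [exact: mK|exact: mfA]);
    try exact: massK.
  move=> p [/andP[p0 pP] Dp]; split=> //; rewrite /K /subgraph /=.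
  rewrite p0 (lt_le_trans pP)// leNgt; exact/negP.
have mdiff (P' Q' : probability T R) : P' `<< nu -> Q' `<< nu -> measurable (K P' `\` K Q').
  by move=> h1 h2; apply: measurableD; exact: mK.
have de0 : 0 <= de := mass_ge0 massPQ.
have massJ : mass U th (K P `|` K Q) (1 + de).
  have -> : K P `|` K Q = K P `|` (K Q `\` K P) by rewrite setDE setUIr setUv setIT.
  apply: massU => //; [exact: mK|exact: mdiff|by rewrite setDE setICA setICr setI0|exact: massK1].
have massDelta : mass U th ((K P `\` K Q) `|` (K Q `\` K P)) (de + de).
  apply: massU => //; [exact: mdiff|exact: mdiff|].
  by apply/seteqP; split=> // p [[? ?] []].
have c0 : 0 < 1 + de by rewrite ltr_pwDl.
have mne := measurable_neq (mV P Pnu) (mV Q Qnu).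
have := sel_diff_le hU ma mb ab mN N_law mth (f := fst) (mK P Pnu) (mK Q Qnu) massJ massDelta c0.
move=> /(_ (ex_intro2 _ _ 1 (massK1 P Pnu) ltr01) (ex_intro2 _ _ 1 (massK1 Q Qnu) ltr01) mne).
move=> h; apply: (le_trans h).
rewrite -[P D]fineK ?fin_num_measure// -[Q D]fineK ?fin_num_measure// -EFinB -EFinM lee_fin -/de.
rewrite ler_pdivrMr//; nra.
Qed.

End poisson_coupling.

(** * Quantile functions and random permutations *)

Section permutation_average.
Context (R : realType).

Lemma sum_dist (n : nat) :
  \sum_(i < n) \sum_(j < n) `|i%:R - j%:R| = n%:R * (n%:R ^+ 2 - 1) / 3 :> R.
Proof.
have gauss m : \sum_(i < m) `|i%:R - m%:R| = m%:R * (m%:R + 1) / 2 :> R.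
  have -> : \sum_(i < m) `|i%:R - m%:R| = \sum_(i < m) (m%:R - i%:R) :> R.
    by apply: eq_bigr => i _; rewrite distrC ger0_norm// subr_ge0 ler_nat ltnW.
  elim: m => [|m IH]; first by rewrite big_ord0 !mul0r.
  rewrite big_ord_recl subr0 (eq_bigr (fun i : 'I_m => m%:R - i%:R)); last first.
    by move=> i _; rewrite /= /bump /= add1n -!natr1; lra.
  by rewrite IH -natr1; lra.
elim: n => [|n IH]; first by rewrite big_ord0 !mul0r.
rewrite big_ord_recr/= (eq_bigr (fun i : 'I_n =>
  \sum_(j < n) `|i%:R - j%:R| + `|i%:R - n%:R|)); last first.
  by move=> i _; rewrite big_ord_recr.
rewrite big_split/= IH gauss big_ord_recr/= subrr normr0 addr0.
rewrite (eq_bigr (fun i : 'I_n => `|i%:R - n%:R|)); last by move=> i _; rewrite distrC.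
by rewrite gauss -natr1; field.
Qed.

Lemma perm_pair (n : nat) (i j i' j' : 'I_n) : i != j -> i' != j' ->
  exists t : 'S_n, t i = i' /\ t j = j'.
Proof.
move=> ij ij'.
exists (tperm i i' * tperm (tperm i i' j) j')%g; rewrite !permM tpermL.
split; last by rewrite tpermL.
have h1 : tperm i i' j != i' by rewrite -[X in _ != X](tpermL i i') (inj_eq perm_inj) eq_sym.
have h2 : j' != i' by rewrite eq_sym.
exact: tpermD h1 h2.
Qed.

(** The sum is the same for all pairs of distinct indices, since permutations
    act transitively on them; hence it is [n`!] times the average of the distance
    over these pairs, given by [sum_dist]. *)
Lemma perm_dist (n : nat) (i j : 'I_n) : i != j ->
  \sum_(s : 'S_n) `|(s i : nat)%:R - (s j : nat)%:R| = (n`!)%:R * ((n%:R + 1) / 3) :> R.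
Proof.
move=> ij.
pose S (i j : 'I_n) : R := \sum_(s : 'S_n) `|(s i : nat)%:R - (s j : nat)%:R|.
have Sc i' j' : i' != j' -> S i' j' = S i j.
  move=> ij'; have [t [<- <-]] := perm_pair ij ij'.
  rewrite /S [RHS](reindex_inj (mulgI t)).
  by apply: eq_bigr => s _; rewrite !permM.
have total : \sum_(i' < n) \sum_(j' < n) S i' j' = (n`!)%:R * (n%:R * (n%:R ^+ 2 - 1) / 3).
  rewrite -sum_dist /S.
  under eq_bigr do rewrite exchange_big/=.
  rewrite exchange_big/= (eq_bigr (fun=> \sum_(i < n) \sum_(j < n) `|i%:R - j%:R|)).
    by rewrite sumr_const mulr_natl card_Sn.
  move=> s _; rewrite [RHS](reindex_inj (@perm_inj _ s)); apply: eq_bigr => k _.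
  by rewrite [RHS](reindex_inj (@perm_inj _ s)).
have n2 : (1 < n)%N.
  rewrite ltnNge; apply/negP => n1; case/eqP: ij; apply: val_inj => /=.
  have := leq_trans (ltn_ord i) n1; have := leq_trans (ltn_ord j) n1.
  by rewrite !ltnS !leqn0 => /eqP -> /eqP ->.
have : \sum_(i' < n) \sum_(j' < n) S i' j' = n%:R * (n.-1%:R * S i j).
  rewrite (eq_bigr (fun=> n.-1%:R * S i j)); first by rewrite sumr_const card_ord [RHS]mulr_natl.
  move=> k _; rewrite (bigD1 k)//= [X in X + _](_ : _ = 0) ?add0r; last first.
    by rewrite /S big1// => s _; rewrite subrr normr0.
  rewrite (eq_bigr (fun=> S i j)); last by move=> l lk; rewrite Sc// eq_sym.
  by rewrite sumr_const cardC1 card_ord mulr_natl.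
rewrite total -/(S i j).
have -> : n.-1%:R = n%:R - 1 :> R by rewrite -subn1 natrB// ltnW.
have n1 : (1 : R) < n%:R by rewrite ltr1n.
move=> e; have h : (n%:R : R) * (n%:R - 1) != 0 by rewrite mulf_neq0// gt_eqF//; lra.
by apply: (mulfI h); rewrite -[LHS]mulrA -e; field.
Qed.

End permutation_average.

(** Total probability over the values of [ka]. *)
Lemma nat_mix d (T : measurableType d) (R : realType) (P : probability T R)
    (ka : T -> nat) (m : nat) (S : nat -> set T) :
  measurable_fun setT ka -> P [set u | (ka u < m)%N] = 1%E ->
  (forall k, measurable (S k)) ->
  P [set u | S (ka u) u] = (\sum_(k < m) P (ka @^-1` [set (k : nat)] `&` S k))%E.
Proof.
move=> mka ka1 mS.
have mst k : measurable (ka @^-1` [set k]) by exact: (measurable_preimage mka).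
pose G k := ka @^-1` [set k] `&` S k.
have mG k : measurable (G k) by exact: measurableI.
have mlt : measurable [set u | (ka u < m)%N].
  exact: (@measurable_preimage _ _ _ _ ka [set k | (k < m)%N] mka).
have mT : measurable [set u | S (ka u) u].
  have -> : [set u | S (ka u) u] = \bigcup_k G k.
    by apply/seteqP; split=> u; [exists (ka u)|move=> [k _ [/= ->]]].
  by apply: bigcup_measurable => k _; exact: mG.
rewrite -(probability_setI1 mT mlt ka1).
have -> : [set u | S (ka u) u] `&` [set u | (ka u < m)%N] = \big[setU/set0]_(k < m) G k.
  rewrite -(bigcup_mkord m G); apply/seteqP; split=> u /=.
    by move=> [h um]; exists (ka u).
  by move=> [k /= km [/= e Sk]]; rewrite e.
rewrite (measure_bigsetU P)//.
by apply/trivIsetP => i j _ _ ij; rewrite -subset0 => u [[/= e1 _] [/= e2 _]]; move: ij; rewrite -e1 -e2 eqxx.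
Qed.

Section steps.
Context (R : realType).
Local Notation TR := (measurableTypeR R).
Variable U : probability TR R.
Hypothesis hU : uniform_law U.

(** The quantile function of the law with weights [p] on the natural numbers. *)
Definition step (p : nat -> R) (u : TR) : nat :=
  least (fun k => (u < \sum_(j < k.+1) p j)%R).

Lemma measurable_step p : measurable_fun setT (step p).
Proof.
by apply: measurable_least => k; apply: measurable_fun_ltr.
Qed.

Section one_law.
Variables (p : nat -> R) (m : nat).
Hypothesis p0 : forall k, (k < m)%N -> 0 <= p k.
Hypothesis p1 : \sum_(j < m) p j = 1.

Lemma partial_mono k l : (k <= l <= m)%N -> \sum_(j < k) p j <= \sum_(j < l) p j.
Proof.
move=> /andP[/subnKC <-]; elim: (l - k)%N => [|i IH] h; first by rewrite addn0.
rewrite addnS big_ord_recr/= (le_trans (IH _))//; first by rewrite ltnW// -addnS.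
by rewrite lerDl p0// -addnS.
Qed.

Lemma stepE k u : (k < m)%N -> 0 <= u < 1 ->
  step p u = k <-> \sum_(j < k) p j <= u < \sum_(j < k.+1) p j.
Proof.
move=> km u01; split.
  have [|ul lmin] := @leastP (fun k => (u < \sum_(j < k.+1) p j)%R).
    by exists m.-1; rewrite (ltn_predK km) p1; case/andP: u01.
  rewrite -/(step p u) in ul lmin *; move=> e; move: ul; rewrite e => -> /=.
  rewrite andbT leNgt; apply/negP => uk; case: k e km uk => [|k] e km uk.
    by move: uk; rewrite big_ord0; case/andP: u01; rewrite leNgt => /negbTE ->.
  by have := lmin k uk; rewrite e ltnn.
move=> /andP[h1 h2]; apply: least_eq => // l lk; rewrite -leNgt (le_trans _ h1)//.
by apply: partial_mono; rewrite lk ltnW.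
Qed.

Lemma step_lt u : 0 <= u < 1 -> (step p u < m)%N.
Proof.
move=> /andP[u0 u1]; have m0 : (0 < m)%N.
  by case: m p1 => //; rewrite big_ord0 => /esym/eqP; rewrite oner_eq0.
have [|_ h] := @leastP (fun k => (u < \sum_(j < k.+1) p j)%R).
  by exists m.-1; rewrite prednK// p1.
by rewrite -(prednK m0) ltnS; apply: h; rewrite prednK// p1.
Qed.

Lemma step_law k : (k < m)%N -> U (step p @^-1` [set k]) = (p k)%:E.
Proof.
move=> km; have m01 : U `[0, 1[%classic = 1%E by exact: uniform01.
rewrite -(probability_setI1 _ _ m01)//; last exact: (measurable_preimage (measurable_step p)).
have -> : step p @^-1` [set k] `&` `[0, 1[%classic =
    `[\sum_(j < k) p j, \sum_(j < k.+1) p j[%classic.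
  apply/seteqP; split=> u /=; rewrite !in_itv/=.
    by move=> [e u01]; apply/stepE.
  move=> h; have u01 : 0 <= u < 1.
    case/andP: h => h1 h2; rewrite (le_trans _ h1) ?sumr_ge0 ?(lt_le_trans h2)//=.
      by rewrite -p1; apply: partial_mono; rewrite km leqnn.
    by move=> i _; apply: p0; apply: ltn_trans km.
  by split=> //; apply/stepE.
rewrite hU.
- by rewrite big_ord_recr/= addrAC subrr add0r.
- by apply: sumr_ge0 => i _; apply: p0; apply: ltn_trans km.
- by apply: partial_mono; rewrite leqnSn.
- by rewrite -p1; apply: partial_mono; rewrite km leqnn.
Qed.

Lemma step_lt1 : U [set u | (step p u < m)%N] = 1%E.
Proof.
have m01 : U `[0, 1[%classic = 1%E by exact: uniform01.
have mst : measurable [set u | (step p u < m)%N].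
  exact: (@measurable_preimage _ _ _ _ (step p) [set k | (k < m)%N] (measurable_step p)).
apply/eqP; rewrite eq_le probability_le1//= -m01; apply: le_measure; rewrite ?inE//.
by move=> u; rewrite /= in_itv; exact: step_lt.
Qed.

End one_law.

(** Where the two steps differ, [u] lies between the cumulative sums of the two
    laws at some index [k < m]; each term is the length of such an interval. *)
Lemma step_diff (p q : nat -> R) m : (forall k, (k < m.+1)%N -> 0 <= p k) ->
  (forall k, (k < m.+1)%N -> 0 <= q k) ->
  \sum_(j < m.+1) p j = 1 -> \sum_(j < m.+1) q j = 1 ->
  (U [set u | step p u <> step q u] <=
    (\sum_(k < m) `|\sum_(j < k.+1) p j - \sum_(j < k.+1) q j|)%:E)%E.
Proof.
move=> p0 q0 p1 q1.
pose P k := \sum_(j < k.+1) p j; pose Q k := \sum_(j < k.+1) q j.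
have m01 : U `[0, 1[%classic = 1%E by exact: uniform01.
have mD : measurable [set u | step p u <> step q u].
  have -> : [set u | step p u <> step q u] =
    ~` (\bigcup_k (step p @^-1` [set k] `&` step q @^-1` [set k])).
    apply/seteqP; split=> u /=; first by move=> h [k _ [/= e1 e2]]; apply: h; rewrite e1 e2.
    by move=> h e; apply: h; exists (step p u).
  apply: measurableC; apply: bigcup_measurable => k _.
  by apply: measurableI; [exact: (measurable_preimage (measurable_step p))|exact: (measurable_preimage (measurable_step q))].
rewrite -(probability_setI1 mD _ m01)//.
pose F k := `[Num.min (P k) (Q k), Num.max (P k) (Q k)[%classic : set TR.
have mF k : measurable (F k) by exact: measurable_itv.
apply: (@le_trans _ _ (U (\big[setU/set0]_(k < m) F k))).
  apply: le_measure; rewrite ?inE.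
  - by apply: measurableI.
  - exact: bigsetU_measurable.
  rewrite -(bigcup_mkord m F) => u [/= ne]; rewrite in_itv/= => /andP[u0 u1].
  have u01 : 0 <= u < 1 by rewrite u0.
  have := step_lt p1 u01; have := step_lt q1 u01; rewrite !ltnS => lq lp.
  have lastP (r : nat -> R) k : (k <= m)%N -> (k < step r u)%N -> \sum_(j < k.+1) r j <= u.
    move=> _ kr; rewrite leNgt; apply/negP => h.
    have [|_ lmin] := @leastP (fun k => (u < \sum_(j < k.+1) r j)%R); first by exists k.
    by have := lmin k h; rewrite leqNgt kr.
  have hitP (r : nat -> R) : \sum_(j < m.+1) r j = 1 -> u < \sum_(j < (step r u).+1) r j.
    move=> r1; have [|h _] := @leastP (fun k => (u < \sum_(j < k.+1) r j)%R).
      by exists m; rewrite r1.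
    exact: h.
  have [pq|qp|//] := ltngtP (step p u) (step q u).
    exists (step p u); first exact: leq_trans pq lq.
    by rewrite /F/= in_itv/= ge_min lt_max /P /Q hitP// (lastP q)// orbT.
  exists (step q u); first exact: leq_trans qp lp.
  by rewrite /F/= in_itv/= ge_min lt_max /P /Q hitP// (lastP p)// orbT.
have FE (k : nat) : (k < m)%N -> (U (F k) <= (`|P k - Q k|)%:E)%E.
  move=> km; rewrite /F.
  have bnd (r : nat -> R) : (forall k, (k < m.+1)%N -> 0 <= r k) -> \sum_(j < m.+1) r j = 1 ->
      0 <= \sum_(j < k.+1) r j <= 1.
    move=> r0 r1; rewrite sumr_ge0 /=; last by move=> j _; apply: r0; apply: leq_trans (ltn_ord j) _; rewrite ltnS ltnW.
    by rewrite -[X in _ <= X]r1; apply: (partial_mono r0); rewrite !ltnS ltnW//= leqnn.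
  have /andP[P0 P1] := bnd p p0 p1; have /andP[Q0 Q1] := bnd q q0 q1.
  rewrite /P /Q; have [PQ|QP] := leP (\sum_(j < k.+1) p j) (\sum_(j < k.+1) q j).
    by rewrite (hU true true P0 PQ Q1) lee_fin distrC ger0_norm// subr_ge0.
  by rewrite (hU true true Q0 (ltW QP) P1) lee_fin ger0_norm// subr_ge0 ltW.
apply: (le_trans (@Boole_inequality _ _ _ U F m _)) => //.
by rewrite -sumEFin; apply: lee_sum => k _; exact: FE.
Qed.

End steps.

(** * The quantile coupling along a random order *)

Section finite_coupling.
Context (R : realType).
Local Notation TR := (measurableTypeR R).
Variable U : probability TR R.
Hypothesis hU : uniform_law U.
Context dT (T : measurableType dT) (n : nat).
Variable x : 'I_n.+1 -> T.
Hypothesis xinj : injective x.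
Hypothesis mx : forall i, measurable [set x i].

Definition wt (P : probability T R) (i : 'I_n.+1) : R := fine (P [set x i]).

Lemma wt_ge0 (P : probability T R) i : 0 <= wt P i. Proof. exact: fine_ge0. Qed.

Lemma finite_lawE (P : probability T R) A : P (range x) = 1%E -> measurable A ->
  P A = (\sum_(i < n.+1) wt P i * \1_A (x i))%:E.
Proof.
move=> P1 mA.
have mr : measurable (range x).
  have -> : range x = \bigcup_(i in setT) [set x i].
    by apply/seteqP; split=> y; [move=> [i _ <-]; exists i|move=> [i _ ->]; exists i].
  by apply: fin_bigcup_measurable => // i _; exact: mx.
rewrite -(probability_setI1 mA mr P1).
pose F (k : nat) := A `&` [set x (inord k)].
have -> : A `&` range x = \big[setU/set0]_(k < n.+1) F k.
  rewrite -(bigcup_mkord n.+1 F); apply/seteqP; split=> y.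
    by move=> [Ay [i _ xi]]; exists (i : nat) => /=; [exact: ltn_ord|split; rewrite // inord_val].
  by move=> [k _ [Ay e]]; split; [exact: Ay|exists (inord k)].
rewrite (measure_bigsetU_ord P xpredT)//; last 2 first.
- by move=> i; apply: measurableI.
- apply/trivIsetP => i j _ _ ij; rewrite -subset0 => y /= [[_ e1] [_ e2]].
  by move: ij; rewrite e1 in e2; rewrite -(inord_val i) -(inord_val j) (xinj e2) eqxx.
rewrite -sumEFin; apply: eq_bigr => i _; rewrite /F inord_val indicE.
have [Ai|nAi] := pselect (A (x i)).
  rewrite mem_set// mulr1 fineK ?fin_num_measure//; congr (P _).
  by apply/seteqP; split=> y; [move=> []|move=> ->].
rewrite memNset// mulr0 (_ : A `&` _ = set0) ?measure0//.
by rewrite -subset0 => y [Ay e]; apply: nAi; rewrite -e.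
Qed.

Lemma wt_sum (P : probability T R) : P (range x) = 1%E -> \sum_(i < n.+1) wt P i = 1.
Proof.
move=> P1; have := finite_lawE P1 measurableT; rewrite probability_setT.
by move=> [->]; apply: eq_bigr => i _; rewrite indicE in_setT mulr1.
Qed.

Local Notation M := #|{: 'S_n.+1}|.

(** The order [s] lists the point [x (s k)] at rank [k]. *)
Definition pw (P : probability T R) (s : 'S_n.+1) (k : nat) : R := wt P (s (inord k)).
Definition uw (k : nat) : R := M%:R^-1.
Definition prm (k : nat) : 'S_n.+1 := nth 1%g (enum {: 'S_n.+1}) k.

Let M0 : (0 : R) < M%:R.
Proof. by rewrite ltr0n; apply/card_gt0P; exists 1%g. Qed.

Lemma prm_sum (f : 'S_n.+1 -> R) : \sum_(k < M) f (prm k) = \sum_s f s.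
Proof.
rewrite -[RHS](@big_enum _ _ _ _ {: 'S_n.+1}) /= (big_nth 1%g) big_mkord.
by rewrite -cardE.
Qed.

Lemma uw_sum : \sum_(k < M) uw k = 1.
Proof. by rewrite /uw sumr_const card_ord -(mulr_natl M%:R^-1 M) divff// gt_eqF. Qed.

Lemma pw_sum (P : probability T R) s : P (range x) = 1%E -> \sum_(k < n.+1) pw P s k = 1.
Proof.
move=> P1; rewrite -(wt_sum P1) [RHS](reindex_inj (@perm_inj _ s)).
by apply: eq_bigr => k _; rewrite /pw inord_val.
Qed.

Variables a b : TR -> TR.
Hypothesis ma : measurable_fun setT a.
Hypothesis mb : measurable_fun setT b.
Hypothesis ab : forall A B, measurable A -> measurable B ->
  U (a @^-1` A `&` b @^-1` B) = (U A * U B)%E.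

Lemma perm_mix (S : nat -> set TR) (z : nat -> R) : (forall k, measurable (S k)) ->
  (forall k, U (S k) = (z k)%:E) ->
  U [set u | S (step uw (a u)) (b u)] = (\sum_(k < M) uw k * z k)%:E.
Proof.
move=> mS Sz.
have uw0 k : (k < M)%N -> 0 <= uw k by move=> _; rewrite /uw invr_ge0 ltW.
have mst := measurableT_comp (measurable_step uw) ma.
rewrite (@nat_mix _ _ _ U (step uw \o a) M (fun k => b @^-1` (S k)))//.
- rewrite -sumEFin; apply: eq_bigr => k _.
  rewrite comp_preimage ab//; last exact: (measurable_preimage (measurable_step uw)).
  by rewrite (step_law hU uw0 uw_sum)// Sz EFinM.
- have := step_lt1 hU uw_sum; rewrite -(fst_law ab)//.
  exact: (@measurable_preimage _ _ _ _ (step uw) [set k | (k < M)%N] (measurable_step uw)).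
- by move=> k; exact: (measurable_preimage mb).
Qed.

(** The variable [a u] chooses the order and [b u] is the level at which the
    quantile functions of all laws are evaluated along this order. *)
Definition qsel (P : probability T R) (s : 'S_n.+1) (v : TR) : T := x (s (inord (step (pw P s) v))).
Definition qcoupling (P : probability T R) (u : TR) : T := qsel P (prm (step uw (a u))) (b u).

Lemma measurable_qsel (P : probability T R) s : measurable_fun setT (qsel P s).
Proof.
have mn : measurable_fun setT (fun j : nat => x (s (inord j))) by move=> _ A mA.
exact: (measurableT_comp mn (measurable_step (pw P s))).
Qed.

Lemma measurable_qcoupling (P : probability T R) : measurable_fun setT (qcoupling P).
Proof.
apply: (measurable_nat_fun (f := step uw \o a) (g := fun k u => qsel P (prm k) (b u))).
  exact: measurableT_comp (measurable_step uw) ma.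
by move=> k; exact: measurableT_comp (measurable_qsel P (prm k)) mb.
Qed.

Lemma qsel_law (P : probability T R) s A : P (range x) = 1%E -> measurable A ->
  U (qsel P s @^-1` A) = P A.
Proof.
move=> P1 mA.
have p0 k : (k < n.+1)%N -> 0 <= pw P s k by move=> _; exact: wt_ge0.
pose S (k : nat) : set TR := if `[< A (x (s (inord k))) >] then setT else set0.
have -> : qsel P s @^-1` A = [set u | S (step (pw P s) u) u].
  by apply/seteqP; split=> u; rewrite /S /qsel /=; case: asboolP.
rewrite (nat_mix (measurable_step (pw P s)) (step_lt1 hU (pw_sum s P1))); last first.
  by move=> k; rewrite /S; case: ifP.
rewrite finite_lawE// -sumEFin [RHS](reindex_inj (@perm_inj _ s)).
apply: eq_bigr => k _; rewrite /S; case: asboolP => h.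
  rewrite setIT (step_law hU p0 (pw_sum s P1))// /pw inord_val indicE.
  by rewrite mem_set ?mulr1//; move: h; rewrite inord_val.
rewrite setI0 measure0 indicE memNset ?mulr0//; move: h; by rewrite inord_val.
Qed.

Lemma qcoupling_law (P : probability T R) A : P (range x) = 1%E -> measurable A ->
  U (qcoupling P @^-1` A) = P A.
Proof.
move=> P1 mA.
rewrite (@perm_mix (fun k => qsel P (prm k) @^-1` A) (fun=> fine (P A))).
- by rewrite -mulr_suml uw_sum mul1r fineK// fin_num_measure.
- by move=> k; exact: (measurable_preimage (measurable_qsel P (prm k))).
- by move=> k; rewrite qsel_law// fineK// fin_num_measure.
Qed.

(** The distance of two ranks is the number of cuts that separate them. *)
Lemma cut_dist (m i j : nat) : (i <= m)%N -> (j <= m)%N ->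
  \sum_(l < m) `|(i <= l)%N%:R - (j <= l)%N%:R| = `|i%:R - j%:R| :> R.
Proof.
have cnt k : (k <= m)%N -> \sum_(l < m) (k <= l)%N%:R = m%:R - k%:R :> R.
  elim: m => [|m IH]; first by rewrite leqn0 => /eqP ->; rewrite big_ord0 subrr.
  rewrite leq_eqVlt => /orP[/eqP ->|km].
    rewrite subrr big1// => l _; by rewrite leqNgt ltn_ord.
  by rewrite big_ord_recr/= IH//; move: km; rewrite ltnS => ->; rewrite mulr1n -natr1; lra.
wlog ij : i j / (i <= j)%N => [hw|].
  have [|/ltnW ji] := leqP i j; first exact: hw.
  move=> im jm; rewrite [RHS]distrC -(hw j i)//; apply: eq_bigr => l _.
  by rewrite distrC.
move=> im jm; rewrite (eq_bigr (fun l : 'I_m => (i <= l)%N%:R - (j <= l)%N%:R)); last first.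
  move=> l _; rewrite ger0_norm// subr_ge0 ler_nat.
  by case: (leqP j l) => // jl; rewrite (leq_trans ij jl).
rewrite sumrB !cnt// distrC ger0_norm ?subr_ge0 ?ler_nat//; lra.
Qed.

Lemma pw_partial (P : probability T R) s (l : nat) : (l < n)%N ->
  \sum_(k < l.+1) pw P s k = \sum_(i < n.+1) wt P i * ((s^-1)%g i <= l)%N%:R.
Proof.
move=> ln; have ln1 : (l.+1 <= n.+1)%N by rewrite ltnS ltnW.
rewrite (big_ord_widen _ (fun k => pw P s k) ln1) big_mkcond/=.
rewrite [RHS](reindex_inj (@perm_inj _ s)); apply: eq_bigr => k _.
rewrite permK ltnS /pw inord_val; case: leqP => _; first by rewrite mulr1.
by rewrite mulr0.
Qed.

(** [w] is an arbitrary joint law with marginals [P] and [Q].  Given the order,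
    the cumulative sums at a cut differ at most by the [w]-mass of the pairs that
    the cut separates.  Summing over the cuts charges each pair its distance in
    the order, whose average over the orders is [perm_dist]. *)
Lemma qcoupling_diff (P Q : probability T R) (w : 'I_n.+1 -> 'I_n.+1 -> R) :
  P (range x) = 1%E -> Q (range x) = 1%E ->
  (forall i j, 0 <= w i j) -> (forall i, \sum_j w i j = wt P i) ->
  (forall j, \sum_i w i j = wt Q j) ->
  (U [set u | qcoupling P u <> qcoupling Q u] <=
   ((n.+1%:R + 1) / 3 * \sum_i \sum_(j | j != i) w i j)%:E)%E.
Proof.
move=> P1 Q1 w0 wP wQ.
pose S k := [set v | step (pw P (prm k)) v <> step (pw Q (prm k)) v].
pose z k := fine (U (S k)).
have mS k : measurable (S k).
  have -> : S k = ~` \bigcup_j (step (pw P (prm k)) @^-1` [set j] `&` step (pw Q (prm k)) @^-1` [set j]).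
    apply/seteqP; split=> u /=; first by move=> h [j _ [/= e1 e2]]; apply: h; rewrite e1 e2.
    by move=> h e; apply: h; exists (step (pw P (prm k)) u).
  apply: measurableC; apply: bigcup_measurable => j _.
  apply: measurableI; first exact: (measurable_preimage (measurable_step (pw P (prm k)))).
  exact: (measurable_preimage (measurable_step (pw Q (prm k)))).
have Sz k : U (S k) = (z k)%:E by rewrite fineK// fin_num_measure.
have mD : measurable [set u | S (step uw (a u)) (b u)].
  have -> : [set u | S (step uw (a u)) (b u)] =
      \bigcup_k ((step uw \o a) @^-1` [set k] `&` b @^-1` (S k)).
    by apply/seteqP; split=> u; [exists (step uw (a u))|move=> [k _ [/= ->]]].
  apply: bigcup_measurable => k _; apply: measurableI.
    exact: (measurable_preimage (measurableT_comp (measurable_step uw) ma)).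
  exact: (measurable_preimage mb).
have mne : measurable [set u | qcoupling P u <> qcoupling Q u].
  have -> : [set u | qcoupling P u <> qcoupling Q u] =
    ~` \bigcup_i (qcoupling P @^-1` [set x i] `&` qcoupling Q @^-1` [set x i]).
    apply/seteqP; split=> u /=.
      by move=> h [i _ [/= e1 e2]]; apply: h; rewrite e1 e2.
    move=> h e; apply: h; pose k := prm (step uw (a u)).
    exists (k (inord (step (pw P k) (b u)))) => //.
  apply: measurableC; apply: fin_bigcup_measurable => // i _.
  by apply: measurableI; [exact: (measurable_preimage (measurable_qcoupling P))|exact: (measurable_preimage (measurable_qcoupling Q))].
apply: (@le_trans _ _ (U [set u | S (step uw (a u)) (b u)])).
  apply: le_measure; rewrite ?inE//.
  by move=> u /= h e; apply: h; rewrite /qcoupling /qsel e.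
rewrite (perm_mix mS Sz) lee_fin.
pose dist (s : 'S_n.+1) := \sum_i \sum_j w i j * `|((s^-1)%g i : nat)%:R - ((s^-1)%g j : nat)%:R|.
apply: (@le_trans _ _ (\sum_(k < M) uw k * dist (prm k))).
  apply: ler_sum => k _; rewrite ler_wpM2l ?invr_ge0 ?(ltW M0)//.
  rewrite -lee_fin -Sz.
  apply: (le_trans (step_diff hU _ _ (pw_sum (prm k) P1) (pw_sum (prm k) Q1))).
  - by move=> j _; exact: wt_ge0.
  - by move=> j _; exact: wt_ge0.
  rewrite lee_fin; set s := prm k.
  pose ind (i : 'I_n.+1) (l : nat) : R := ((s^-1)%g i <= l)%N%:R.
  apply: (@le_trans _ _ (\sum_(l < n) \sum_i \sum_j w i j * `|ind i l - ind j l|)).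
    apply: ler_sum => l _; rewrite !pw_partial//.
    have -> : \sum_i wt P i * ind i l - \sum_i wt Q i * ind i l =
        \sum_i \sum_j w i j * (ind i l - ind j l).
      under [in RHS]eq_bigr do (under eq_bigr do rewrite mulrBr; rewrite sumrB -mulr_suml wP).
      rewrite sumrB; congr (_ - _); rewrite exchange_big/=.
      by apply: eq_bigr => j _; rewrite -mulr_suml wQ.
    apply: (le_trans (ler_norm_sum _ _ _)); apply: ler_sum => i _.
    apply: (le_trans (ler_norm_sum _ _ _)); apply: ler_sum => j _.
    by rewrite normrM ger0_norm.
  rewrite exchange_big/=; apply: ler_sum => i _.
  rewrite exchange_big/=; apply: ler_sum => j _.
  rewrite -mulr_sumr ler_wpM2l//.
  by rewrite cut_dist// -ltnS.
rewrite -mulr_sumr prm_sum /uw /dist exchange_big/= mulr_sumr mulr_sumr.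
apply: ler_sum => i _.
rewrite exchange_big/= (bigID (fun j => j == i))/= big_pred1_eq [X in X + _]big1 ?add0r; last first.
  by move=> s _; rewrite subrr normr0 mulr0.
rewrite !mulr_sumr; apply: ler_sum => j ji.
rewrite -mulr_sumr (reindex_inj invg_inj)/=.
under eq_bigr do rewrite invgK.
rewrite perm_dist 1?eq_sym// -card_Sn.
by rewrite le_eqVlt; apply/orP; left; apply/eqP; field; rewrite gt_eqF.
Qed.

End finite_coupling.

(** * Mixtures, conditioning and resampling *)

Section lower_bound_laws.
Context (R : realType).
Local Notation TR := (measurableTypeR R).

(** Every value differs from [C p] or from [C q].  So the rows [p] and [q] have
    together at least [m] disagreements, and each other row at least one. *)
Lemma count_pairs (T : Type) (m : nat) (C : 'I_m -> T) (p q : 'I_m) : C p <> C q ->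
  2 * (m%:R - 1) <= \sum_i \sum_j (`[< C i <> C j >])%:R :> R.
Proof.
move=> Cpq; pose c i j : R := (`[< C i <> C j >])%:R.
have c0 i j : 0 <= c i j by [].
have pq : q != p by apply/eqP => pq; apply: Cpq; rewrite pq.
have cpq r : 1 <= c p r + c q r.
  rewrite /c; case: asboolP => h1; case: asboolP => h2; rewrite ?mulr1n ?mulr0n; try lra.
  by exfalso; apply: Cpq; transitivity (C r); [exact: contrapT|apply/esym; exact: contrapT].
have cC i j : c i j = c j i.
  by rewrite /c; congr (_%:R); congr nat_of_bool; apply/asboolP/asboolP => h e; apply: h.
rewrite (bigD1 p)//= [X in _ <= _ + X](bigD1 q)//=.
rewrite addrA -big_split/=.
have h1 : m%:R <= \sum_j (c p j + c q j).
  by rewrite -[X in X%:R <= _](card_ord m) -sum1_card natr_sum; apply: ler_sum.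
have h2 : m%:R - 2 <= \sum_(i | (i != p) && (i != q)) \sum_j c i j.
  apply: (@le_trans _ _ (\sum_(i | (i != p) && (i != q)) 1)); last first.
    apply: ler_sum => i _; rewrite (le_trans (cpq i))// (bigD1 p)//= [X in _ <= _ + X](bigD1 q)//=.
    by rewrite (cC p) (cC q) addrA lerDl sumr_ge0.
  have : \sum_(i < m) (1 : R) = m%:R by rewrite sumr_const card_ord.
  by rewrite (bigD1 p)//= [X in _ + X = _](bigD1 q)//=; lra.
by have := lerD h1 h2; lra.
Qed.

Variable U : probability TR R.
Hypothesis hU : uniform_law U.
Context dT (T : measurableType dT).
Variables (i : T -> TR) (s : TR -> T).
Hypothesis mi : measurable_fun setT i.
Hypothesis ms : measurable_fun setT s.
Hypothesis is_ : cancel i s.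
Variables a b : TR -> TR.
Hypothesis ma : measurable_fun setT a.
Hypothesis mb : measurable_fun setT b.
Hypothesis ab : forall A B, measurable A -> measurable B ->
  U (a @^-1` A `&` b @^-1` B) = (U A * U B)%E.

(** One uniform variable chooses the component, an independent one a point of
    it. *)
Lemma mixture (m : nat) (c : 'I_m.+1 -> R) (Q : 'I_m.+1 -> probability T R) :
  (forall k, 0 <= c k) -> \sum_k c k = 1 ->
  exists P : probability T R, forall A, measurable A ->
    P A = (\sum_k c k * fine (Q k A))%:E.
Proof.
move=> c0 c1.
have /choice[psi psiP] : forall k, exists psi : TR -> T, measurable_fun setT psi /\
    forall A, measurable A -> U (psi @^-1` A) = Q k A.
  by move=> k; exact: (realize_law mi ms is_ hU (Q k)).
pose p (k : nat) : R := c (inord k).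
have p0 k : (k < m.+1)%N -> 0 <= p k by move=> _; exact: c0.
have p1 : \sum_(k < m.+1) p k = 1.
  by rewrite -c1; apply: eq_bigr => k _; rewrite /p inord_val.
have mst := measurableT_comp (measurable_step p) ma.
pose f u := psi (inord (step p (a u))) (b u).
have mf : measurable_fun setT f.
  apply: (measurable_nat_fun (f := step p \o a) (g := fun k u => psi (inord k) (b u))) => // k.
  exact: (measurableT_comp (psiP _).1 mb).
exists (distribution U (mfun_of mf)) => A mA.
rewrite -[LHS]/(U (f @^-1` A)).
have mps k : measurable (psi k @^-1` A) by exact: (measurable_preimage (psiP k).1 mA).
rewrite (@nat_mix _ _ _ U (step p \o a) m.+1 (fun k => b @^-1` (psi (inord k) @^-1` A)))//.
- rewrite -sumEFin; apply: eq_bigr => k _.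
  rewrite comp_preimage ab//; last exact: (measurable_preimage (measurable_step p)).
  rewrite (step_law hU p0 p1)// EFinM /p inord_val; congr (_ * _)%E.
  by rewrite (psiP k).2// fineK// fin_num_measure.
- have := step_lt1 hU p1; rewrite -(fst_law ab)//.
  exact: (@measurable_preimage _ _ _ _ (step p) [set k | (k < m.+1)%N] (measurable_step p)).
- by move=> k; exact: (measurable_preimage mb).
Qed.

Lemma conditional (nu : probability T R) O : measurable O -> nu O != 0%E ->
  exists Q : probability T R, Q O = 1%E /\
    forall A, measurable A -> nu A = 0%E -> Q A = 0%E.
Proof.
move=> mO nuO.
have fin : nu O \is a fin_num by rewrite fin_num_measure.
pose Q := mnormalize (mrestr nu mO) nu.
have QE A : Q A = (nu (A `&` O) * (fine (nu O))^-1%:E)%E.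
  rewrite /Q /= /mnormalize /= /mrestr setTI (negbTE nuO)/=.
  by rewrite ifF//; apply/eqP => e; move: fin; rewrite e.
exists Q; split=> [|A mA A0].
  by rewrite [LHS]QE setIid -{1}[nu O]fineK// -EFinM divff// fine_eq0.
rewrite [LHS]QE (_ : nu _ = 0%E) ?mul0e//; apply/eqP.
rewrite eq_le measure_ge0 andbT -A0; apply: le_measure; rewrite ?inE//.
exact: measurableI.
Qed.

(** Sample [P], and sample anew from [Q] when the result is in [O]. *)
Lemma redirect (P Q : probability T R) O : measurable O ->
  exists Y Z : TR -> T, [/\ measurable_fun setT Y, measurable_fun setT Z,
    forall A, measurable A -> U (Y @^-1` A) = P A,
    forall A, measurable A -> U (Z @^-1` A) = (P (A `\` O) + P O * Q A)%E &
    [set u | Y u <> Z u] `<=` Y @^-1` O].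
Proof.
move=> mO.
have [psi [mpsi psiE]] := realize_law mi ms is_ hU P.
have [chi [mchi chiE]] := realize_law mi ms is_ hU Q.
have mO' := measurable_preimage mpsi mO.
pose Y u := psi (a u).
pose Z u := if `[< O (psi (a u)) >] then chi (b u) else psi (a u).
have mY : measurable_fun setT Y by exact: measurableT_comp.
have mYO := measurable_preimage mY mO.
have mZ : measurable_fun setT Z.
  apply: measurable_fun_ifT => //; last exact: measurableT_comp.
  exact: measurable_asbool.
exists Y, Z; split=> // [A mA|A mA|u /= ne].
- by rewrite -[LHS]/(U (a @^-1` (psi @^-1` A))) (fst_law ab) ?psiE//; exact: measurable_preimage.
- have -> : Z @^-1` A = (a @^-1` (psi @^-1` (A `\` O))) `|`
      (a @^-1` (psi @^-1` O) `&` b @^-1` (chi @^-1` A)).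
    apply/seteqP; split=> u; rewrite /Z /=; case: asboolP => h; [by right|by left|by case=> [[]|[]]|].
    by case=> [[]|[]].
  have mAO := measurable_preimage mpsi (measurableD mA mO).
  have mcA := measurable_preimage mchi mA.
  rewrite probability_setU.
  + by rewrite (fst_law ab mAO) (ab mO' mcA) !(psiE, chiE)//; exact: measurableD.
  + exact: (measurable_preimage ma mAO).
  + by apply: measurableI; [exact: (measurable_preimage ma mO')|exact: (measurable_preimage mb mcA)].
  + by rewrite -subset0 => u [/= [_ nO] [yO _]]; exact: nO.
- by apply: contrapT => nO; apply: ne; rewrite /Z; case: asboolP.
Qed.

End lower_bound_laws.

(** * Couplings on the unit interval *)

Section unit_interval_couplings.
Context (R : realType) (X : ptopologicalType).
Local Notation TR := (measurableTypeR R).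
Local Notation law := (probability (borel X) R).
Local Notation la := (@lebesgue01 R).
Local Notation random_element := {RV (@lebesgue01 R) >-> borel X}.
Local Notation cost := (discrete_cost R (X := X)).

Lemma unif_uniform : uniform_law (unif R).
Proof. by move=> a b c e a0 ab b1; exact: unif_itv. Qed.

Definition rv_of (g : TR -> borel X) (mg : measurable_fun setT g) : random_element :=
  mfun_of (measurableT_comp mg (@measurable_unit_val R)).

Lemma rv_of_law g mg (P : law) : (forall A, measurable A -> unif R (g @^-1` A) = P A) ->
  has_law (@rv_of g mg) P.
Proof. by move=> gP A mA; rewrite -gP. Qed.

Variables (i : borel X -> TR) (s : TR -> borel X).
Hypothesis mi : measurable_fun setT i.
Hypothesis ms : measurable_fun setT s.
Hypothesis is_ : cancel i s.

Lemma measurable_RV_neq (Y Z : random_element) : measurable [set t | Y t <> Z t].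
Proof. exact: (measurable_neq mi is_). Qed.

Lemma expected_costE (Y Z : random_element) :
  expected_cost cost Y Z = la [set t | Y t <> Z t].
Proof.
have mD := measurable_RV_neq Y Z.
rewrite /expected_cost unlock.
rewrite (eq_integral (fun t => (\1_[set t | Y t <> Z t] t)%:E)); last first.
  move=> t _; congr EFin; rewrite /discrete_cost indicE; congr (_%:R); congr nat_of_bool.
  by apply/idP/idP => [/eqP h|]; [exact: mem_set|move=> /set_mem h; apply/eqP].
by rewrite integral_indic// setIT.
Qed.

Lemma le_transport (P Q : law) (r : R) (e : \bar R) : 0 < r ->
  (forall Y Z, has_law Y P -> has_law Z Q -> (e <= r%:E * la [set t | Y t <> Z t])%E) ->
  (e <= r%:E * transport_cost cost P Q)%E.
Proof.
move=> r0 h; rewrite -lee_pdivrMl//.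
apply: le_ereal_inf_tmp => _ [Y [Z [YP ZQ ->]]].
by rewrite lee_pdivrMl// expected_costE; exact: h.
Qed.

Lemma transport_le (P Q : law) Y Z : has_law Y P -> has_law Z Q ->
  (transport_cost cost P Q <= la [set t | Y t <> Z t])%E.
Proof.
move=> YP ZQ; apply: ge_ereal_inf; exists (expected_cost cost Y Z).
  by exists Y, Z.
by rewrite expected_costE.
Qed.

Lemma law_diff_le (P Q : law) Y Z D : has_law Y P -> has_law Z Q -> measurable D ->
  (P D - Q D <= la [set t | Y t <> Z t])%E.
Proof.
move=> YP ZQ mD; have mne := measurable_RV_neq Y Z.
have mY : measurable (Y @^-1` D) by exact: (measurable_preimage (measurable_funPT Y)).
have mZ : measurable (Z @^-1` D) by exact: (measurable_preimage (measurable_funPT Z)).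
rewrite -(YP D mD) -(ZQ D mD) /distribution /pushforward leeBlDr ?fin_num_measure//.
apply: (@le_trans _ _ (la ([set t | Y t <> Z t] `|` Z @^-1` D))).
  apply: le_measure; rewrite ?inE//; first exact: measurableU.
  move=> t YD; have [e|ne] := pselect (Y t = Z t); last by left.
  by right; rewrite /= -e.
exact: measureU2.
Qed.

Lemma coupling_ratio_le (I : Type) (P : I -> law) (Y : I -> random_element) (r : R) : 1 <= r ->
  (forall j k, (la [set t | Y j t <> Y k t] <= r%:E * transport_cost cost (P j) (P k))%E) ->
  (coupling_ratio cost P Y <= r%:E)%E.
Proof.
move=> r1 h; apply: ge_ereal_inf; exists r%:E => //; exists r => //; split=> // j k.
by rewrite expected_costE.
Qed.

End unit_interval_couplings.

(** * Both upper bounds and the lower bound *)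

Section polish_couplings.
Context (R : realType) (X : ptopologicalType).
Local Notation TR := (measurableTypeR R).
Local Notation law := (probability (borel X) R).
Local Notation la := (@lebesgue01 R).
Local Notation random_element := {RV (@lebesgue01 R) >-> borel X}.
Local Notation cost := (discrete_cost R (X := X)).
Variables (i : borel X -> TR) (s : TR -> borel X).
Hypothesis mi : measurable_fun setT i.
Hypothesis ms : measurable_fun setT s.
Hypothesis is_ : cancel i s.
Variable mu : {sigma_finite_measure set (borel X) -> \bar R}.
Variable nu : law.
Hypothesis munu : forall A, measurable A -> nu A = 0%E <-> mu A = 0%E.

Local Notation hU := (@unif_uniform R).
Local Notation family := (self_indexed (ac_probabilities mu)).

Lemma ac_nu (P : law) : P `<< mu -> P `<< nu.
Proof.
move=> /null_content_dominatesP h; apply/null_content_dominatesP => A mA /(munu mA).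
exact: h.
Qed.

Lemma family_ac (P : ac_probabilities mu) : family P `<< mu.
Proof. exact: (set_valP P). Qed.

(** [P D - Q D] is a lower bound for the probability that any two variables with
    laws [P] and [Q] differ. *)
Lemma general_upper : exists Y : ac_probabilities mu -> random_element,
  is_coupling family Y /\ (coupling_ratio cost family Y <= 2%:E)%E.
Proof.
have [V [mV lawV diffV]] := poisson_coupling mi ms is_ hU nu.
pose Y P := rv_of (mV (family P) (ac_nu (family_ac P))).
have Ylaw : is_coupling family Y.
  by move=> P; apply: rv_of_law => A mA; exact: (lawV _ _ (ac_nu (family_ac P)) mA).
exists Y; split=> //; apply: (coupling_ratio_le mi is_) => [|P Q]; first by rewrite ler1n.
have [D mD h] := diffV _ _ (ac_nu (family_ac P)) (ac_nu (family_ac Q)).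
apply: (le_transport mi is_) => // Y' Z' YP ZQ.
apply: (le_trans h); rewrite lee_pmul2l ?lte_fin//.
exact: (law_diff_le mi is_ YP ZQ mD).
Qed.

Lemma finite_partition d (T : measurableType d) (P : probability T R) (n : nat)
    (x : 'I_n.+1 -> borel X) (Z : T -> borel X) B :
  injective x -> (forall k, measurable [set x k]) -> measurable_fun setT Z ->
  P (Z @^-1` range x) = 1%E -> measurable B ->
  \sum_k fine (P (B `&` Z @^-1` [set x k])) = fine (P B).
Proof.
move=> xinj mx mZ P1 mB.
pose F (k : nat) := B `&` Z @^-1` [set x (inord k)].
have mZx k : measurable (Z @^-1` [set x k]) by exact: (measurable_preimage mZ (mx k)).
have U1 : \big[setU/set0]_(k < n.+1) F k = B `&` Z @^-1` range x.
  rewrite -(bigcup_mkord n.+1 F); apply/seteqP; split=> t.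
    by move=> [k _ [Bt e]]; split=> //; exists (inord k).
  by move=> [Bt [k _ e]]; exists (k : nat) => /=; [exact: ltn_ord|split; rewrite //= inord_val].
have mF k : measurable (F k) by apply: measurableI.
have mr : measurable (Z @^-1` range x).
  have -> : Z @^-1` range x = \big[setU/set0]_(k < n.+1) (Z @^-1` [set x (inord k)]).
    rewrite -(bigcup_mkord n.+1 (fun k => Z @^-1` [set x (inord k)])).
    apply/seteqP; split=> t; last by move=> [k _ e]; exists (inord k).
    by move=> [k _ e]; exists (k : nat) => /=; [exact: ltn_ord|rewrite inord_val].
  by apply: bigsetU_measurable.
rewrite -(probability_setI1 mB mr P1) -U1 (measure_bigsetU_ord P xpredT)//; last first.
  apply/trivIsetP => j k _ _ jk; rewrite -subset0 => t [[_ e1] [_ e2]].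
  by move: jk; rewrite /= e1 in e2; rewrite -(inord_val j) -(inord_val k) (xinj _ _ e2) eqxx.
rewrite -sum_fine; last by move=> k _; rewrite fin_num_measure.
by apply: eq_bigr => k _; rewrite /F inord_val.
Qed.

(** The joint law of an arbitrary pair of variables with laws [P] and [Q] serves
    as [w] in [qcoupling_diff]; its mass off the diagonal is the probability that
    they differ. *)
Lemma finite_upper (n : nat) (x : 'I_n.+1 -> borel X) :
  injective x -> (0 < n)%N -> (forall P : law, P `<< mu -> P (range x) = 1%E) ->
  exists Y : ac_probabilities mu -> random_element,
  is_coupling family Y /\
  (coupling_ratio cost family Y <= ((n.+1%:R + 1) / 3)%:E)%E.
Proof.
move=> xinj n0 supp.
have mx k : measurable [set x k].
  have -> : [set x k] = i @^-1` [set i (x k)].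
    by apply/seteqP; split=> y /= => [->//|]; exact: (can_inj is_).
  by apply: (measurable_preimage mi); exact: measurable_set1.
have [a [b [ma mb ab]]] := split_uniform hU.
pose Y P := rv_of (measurable_qcoupling x ma mb (family P)).
have Ylaw : is_coupling family Y.
  move=> P; apply: rv_of_law => A mA.
  by apply: (qcoupling_law hU xinj mx ma mb ab) => //; apply: supp; exact: family_ac.
have r1 : (1 : R) <= (n.+1%:R + 1) / 3.
  rewrite ler_pdivlMr// mul1r -natr1; have : (1 : R) <= n%:R by rewrite ler1n.
  by lra.
exists Y; split=> //; apply: (coupling_ratio_le mi is_) => // P Q.
apply: (le_transport mi is_) => [|Y' Z' YP ZQ]; first exact: lt_le_trans r1.
have P1 : family P (range x) = 1%E by apply: supp; exact: family_ac.
have Q1 : family Q (range x) = 1%E by apply: supp; exact: family_ac.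
have mr : measurable (range x).
  have -> : range x = \bigcup_(k in setT) [set x k].
    by apply/seteqP; split=> y; [move=> [k _ <-]; exists k|move=> [k _ ->]; exists k].
  by apply: fin_bigcup_measurable => // k _; exact: mx.
have mY : measurable_fun setT Y' by exact: measurable_funPT.
have mZ : measurable_fun setT Z' by exact: measurable_funPT.
have Y1 : la (Y' @^-1` range x) = 1%E by rewrite -P1 -(YP _ mr).
have Z1 : la (Z' @^-1` range x) = 1%E by rewrite -Q1 -(ZQ _ mr).
have mYk k : measurable (Y' @^-1` [set x k]) by exact: (measurable_preimage mY (mx k)).
have mZk k : measurable (Z' @^-1` [set x k]) by exact: (measurable_preimage mZ (mx k)).
pose w j k := fine (la (Y' @^-1` [set x j] `&` Z' @^-1` [set x k])).
have mD := measurable_RV_neq mi is_ Y' Z'.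
set D := [set t | _] in mD *.
apply: (@le_trans _ _ ((n.+1%:R + 1) / 3 * \sum_j \sum_(k | k != j) w j k)%:E).
  apply: (qcoupling_diff hU xinj mx ma mb ab P1 Q1).
  - by move=> j k; exact: fine_ge0.
  - by move=> j; rewrite finite_partition// /wt -(YP _ (mx j)).
  - move=> k; rewrite /wt -(ZQ _ (mx k)) -(finite_partition xinj mx mY Y1 (mZk k)).
    by apply: eq_bigr => j _; rewrite /w setIC.
rewrite -[la D]fineK ?fin_num_measure// -EFinM lee_fin ler_wpM2l//.
rewrite -(finite_partition xinj mx mY Y1 mD); apply: ler_sum => j _.
have mDj : measurable (D `&` Y' @^-1` [set x j]) by exact: measurableI.
rewrite -(finite_partition xinj mx mZ Z1 mDj) [leRHS](bigID (fun k => k == j))/=.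
rewrite -[leLHS]add0r lerD//; first by apply: sumr_ge0 => k _; exact: fine_ge0.
rewrite le_eqVlt; apply/orP; left; apply/eqP; apply: eq_bigr => k kj.
rewrite /w; congr (fine (la _)); apply/seteqP; split=> t /= [].
  by move=> Yj Zk; split=> //; split=> //; rewrite /D /= Yj Zk => /xinj e; move: kj; rewrite e eqxx.
by move=> [_ Yj] Zk.
Qed.

(** [P j] averages the laws [Q k], conditioned on [O k], over [k != j].  To go
    from [P j] to [P k] it is enough to resample from [Q j] the mass
    [m.+1%:R^-1] that [P j] has in [O k].  On the other hand [P j] vanishes on
    [O j], so the variables of a coupling are almost surely not all equal, and
    [count_pairs] bounds the expected number of disagreements. *)
Lemma lower_bound (m : nat) (O : 'I_m.+2 -> set X)
    (Y : ac_probabilities mu -> random_element) (r : R) :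
  (forall k, measurable (O k : set (borel X))) -> (forall k, nu (O k) != 0%E) ->
  (forall j k, j != k -> O j `&` O k = set0) ->
  is_coupling family Y -> 1 <= r ->
  (forall P Q, (la [set t | Y P t <> Y Q t] <= r%:E * transport_cost cost (family P) (family Q))%E) ->
  2 * (m.+2%:R - 1) <= m.+2%:R * r.
Proof.
move=> mO nuO OO Ylaw r1 hr.
have [a [b [ma mb ab]]] := split_uniform hU.
have /choice[Q QP] : forall k, exists Q : law, Q (O k) = 1%E /\
    forall A, measurable A -> nu A = 0%E -> Q A = 0%E.
  by move=> k; exact: (conditional (mO k) (nuO k)).
have QO j k : j != k -> Q j (O k) = 0%E.
  move=> jk; apply/eqP; rewrite eq_le measure_ge0 andbT.
  have <- : Q j (~` O j) = 0%E by rewrite (probability_setC (Q j) (mO j)) (QP j).1 subee.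
  apply: le_measure; rewrite ?inE//; first exact: measurableC.
  by move=> y Ok Oj; have : (O j `&` O k) y by []; rewrite OO.
pose c (j k : 'I_m.+2) : R := if k == j then 0 else m.+1%:R^-1.
have c0 j k : 0 <= c j k by rewrite /c; case: ifP.
have csum j : \sum_k c j k = 1.
  rewrite (bigD1 j)//= {1}/c eqxx add0r (eq_bigr (fun=> m.+1%:R^-1)).
    by rewrite sumr_const cardC1 card_ord -(mulr_natl m.+1%:R^-1 m.+1) divff.
  by move=> k kj; rewrite /c (negbTE kj).
have /choice[P PE] : forall j, exists P : law, forall A, measurable A ->
    P A = (\sum_k c j k * fine (Q k A))%:E.
  by move=> j; exact: (mixture hU mi ms is_ ma mb ab Q (c0 j) (csum j)).
have Pac j : P j `<< mu.
  apply/null_content_dominatesP => A mA /(munu mA) nuA.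
  rewrite PE// big1// => k _; by rewrite (QP k).2//= mulr0.
have Pin j : ac_probabilities mu (P j) := Pac j.
pose Pj j : ac_probabilities mu := SigSub (mem_set (Pin j)).
have PjE j : family (Pj j) = P j by [].
have POE j k : P j (O k) = (c j k)%:E.
  rewrite PE// (bigD1 k)//= (QP k).1/= mulr1 big1 ?addr0// => l lk.
  by rewrite QO//= mulr0.
(* Resampling from [Q j] on [O k] turns [P j] into [P k]. *)
have tcost j k : j != k -> (transport_cost cost (P j) (P k) <= (m.+1%:R^-1)%:E)%E.
  move=> jk; have [Y' [Z' [mY' mZ' Y'law Z'law sub]]] :=
    redirect hU mi ms is_ ma mb ab (P j) (Q j) (mO k).
  have Ylaw' : has_law (rv_of mY') (P j) by apply: rv_of_law.
  have Zlaw' : has_law (rv_of mZ') (P k).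
    apply: rv_of_law => A mA; rewrite Z'law//.
    have mAO : measurable (A `\` O k) by exact: measurableD.
    rewrite POE PE// PE// -[Q j A]fineK ?fin_num_measure// -EFinM -EFinD; congr EFin.
    have QkD : fine (Q k (A `\` O k)) = 0.
      suff -> : Q k (A `\` O k) = 0%E by [].
      apply/eqP; rewrite eq_le measure_ge0 andbT.
      have <- : Q k (~` O k) = 0%E by rewrite (probability_setC (Q k) (mO k)) (QP k).1 subee.
      by apply: le_measure; rewrite ?inE//; exact: measurableC.
    have QlD l : l != k -> fine (Q l (A `\` O k)) = fine (Q l A).
      move=> lk; congr fine; have mCO := measurableC (mO k).
      rewrite setDE probability_setI1// (probability_setC (Q l) (mO k)) QO//.
      by rewrite sube0.
    rewrite (bigD1 k)//= QkD mulr0 add0r (bigD1 j)//= [in LHS]/c eqxx mul0r add0r.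
    rewrite [RHS](bigD1 k)//= [in RHS]/c eqxx mul0r add0r [RHS](bigD1 j)//=.
    rewrite addrC (negbTE jk) eq_sym (negbTE jk); congr (_ + _).
    apply: eq_bigr => l /andP[lk lj].
    by rewrite (negbTE lk) (negbTE lj) QlD.
  apply: (le_trans (transport_le mi is_ Ylaw' Zlaw')).
  have -> : (m.+1%:R^-1)%:E = la (rv_of mY' @^-1` O k).
    by apply/esym; rewrite -[LHS]/(distribution la (rv_of mY') (O k)) (Ylaw' _ (mO k)) POE /c eq_sym (negbTE jk).
  apply: le_measure; rewrite ?inE; last by move=> t; exact: sub.
    exact: (measurable_RV_neq mi is_ (rv_of mY') (rv_of mZ')).
  exact: (measurable_preimage (measurable_funPT (rv_of mY')) (mO k)).
pose C t (j : 'I_m.+2) := Y (Pj j) t.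
pose N j k : set (unit_interval R) := [set t | C t j <> C t k].
have mN j k : measurable (N j k) by exact: measurable_RV_neq mi is_ _ _.
have ub : \sum_j \sum_k fine (la (N j k)) <= m.+2%:R * r.
  rewrite -[X in X%:R * _](card_ord m.+2) -sum1_card natr_sum mulr_suml.
  apply: ler_sum => j _; rewrite mul1r (bigD1 j)//= [X in X + _](_ : _ = 0); last first.
    by rewrite (_ : N j j = set0) ?measure0//; apply/seteqP; split=> t.
  rewrite add0r; apply: (@le_trans _ _ (\sum_(k | k != j) r / m.+1%:R)).
    apply: ler_sum => k kj; rewrite -lee_fin fineK ?fin_num_measure//.
    apply: (le_trans (hr (Pj j) (Pj k))); rewrite EFinM lee_pmul2l//.
      by rewrite !PjE; apply: tcost; rewrite eq_sym.
    by rewrite lte_fin (lt_le_trans _ r1).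
  by rewrite sumr_const cardC1 card_ord -(mulr_natr (r / m.+1%:R) m.+1) divfK.
apply: le_trans ub.
(* If the variable of index 0 is in [O k], that of index [k] is elsewhere. *)
have aeC : {ae la, forall t, [set: unit_interval R] t ->
    ((2 * (m.+2%:R - 1))%:E <= \sum_(p : 'I_m.+2 * 'I_m.+2) (\1_(N p.1 p.2) t : R)%:E)%E}.
  have nbad j : {ae la, forall t, ~ O j (C t j)}.
    exists (C ^~ j @^-1` O j); split.
    - exact: (measurable_preimage (measurable_funPT (Y (Pj j))) (mO j)).
    - by have := Ylaw (Pj j) _ (mO j); rewrite PjE POE /c eqxx.
    - by move=> t /= /contrapT.
  have mU : measurable (\bigcup_(k in setT) O k : set (borel X)).
    by apply: fin_bigcup_measurable => // k _; exact: mO.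
  have inU : {ae la, forall t, exists k, O k (C t ord0)}.
    exists (C ^~ ord0 @^-1` (~` \bigcup_(k in setT) O k)); split.
    - exact: (measurable_preimage (measurable_funPT (Y (Pj ord0))) (measurableC mU)).
    - have := Ylaw (Pj ord0) _ (measurableC mU); rewrite PjE /distribution /pushforward => ->.
      rewrite (probability_setC (P ord0) mU) (_ : P ord0 _ = 1%E) ?subee//.
      rewrite PE// -[RHS](congr1 EFin (csum ord0)); congr EFin; apply: eq_bigr => k _.
      rewrite (_ : Q k _ = 1%E) ?mulr1//; apply/eqP; rewrite eq_le probability_le1//=.
      rewrite -(QP k).1; apply: le_measure; rewrite ?inE//.
      by move=> y Ok; exists k.
    - by move=> t /= h [k _ Ok]; apply: h; exists k.
  have nball : {ae la, forall t, forall j, ~ O j (C t j)} by apply: filter_forall.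
  apply: (filterS2 _ _ inU nball) => t [k Ok] nb _.
  have ne : C t k <> C t ord0 by move=> e; apply: (nb k); rewrite e.
  apply: (@le_trans _ _ (\sum_j \sum_l (`[< C t j <> C t l >])%:R)%:E).
    by rewrite lee_fin; exact: (count_pairs R ne).
  rewrite sumEFin lee_fin pair_bigA/= le_eqVlt; apply/orP; left; apply/eqP.
  by apply: eq_bigr => -[j l] _ /=; rewrite indicE /N.
have mf p : measurable_fun setT (fun t => (\1_(N p.1 p.2) t : R)%:E).
  by apply/measurable_EFinP; exact: measurable_indic.
have : ((2 * (m.+2%:R - 1))%:E <= \sum_(p : 'I_m.+2 * 'I_m.+2) la (N p.1 p.2))%E.
  have -> : (\sum_(p : 'I_m.+2 * 'I_m.+2) la (N p.1 p.2))%E =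
      (\int[la]_t \sum_(p : 'I_m.+2 * 'I_m.+2) (\1_(N p.1 p.2) t : R)%:E)%E.
    rewrite ge0_integral_sum//.
    by apply: eq_bigr => p _; rewrite integral_indic// setIT.
  apply: le_trans (ae_ge0_le_integral _ _ _ _ _ aeC) => //.
  - by rewrite integral_cst//= probability_setT mule1.
  - by move=> t _; apply: sume_ge0 => p _; rewrite lee_fin.
  - by apply: emeasurable_sum.
rewrite pair_bigA/= -lee_fin -sumEFin => h; apply: (le_trans h).
by apply: lee_sum => p _; rewrite fineK// fin_num_measure.
Qed.

End polish_couplings.

(** * The support of the measure *)

Lemma finite_enum (R : realType) (T : pointedType) (A : set T) : finite_set A ->
  exists (m : nat) (x : 'I_m -> T),
    [/\ injective x, range x = A & counting A = m%:R%:E :> \bar R].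
Proof.
move=> fA; pose r : seq T := finmap.enum_fset (fset_set A).
exists (size r), (fun k => nth point r k); split=> [j k /eqP||].
- by rewrite nth_uniq ?finmap.fset_uniq// => /eqP/val_inj.
- apply/seteqP; split=> y.
    by move=> [k _ <-]; apply/set_mem; rewrite -(in_fset_set fA) mem_nth.
  move=> Ay; have yr : y \in r by move/mem_set : Ay; rewrite -(in_fset_set fA).
  have lt : (index y r < size r)%N by rewrite index_mem.
  by exists (Ordinal lt) => //=; rewrite nth_index.
- by rewrite /counting asboolT.
Qed.

Section support.
Context (R : realType) (X : ptopologicalType).
Variable mu : {sigma_finite_measure set (borel X) -> \bar R}.

(** The complement of the support is the union of the null sets of a countable
    base. *)
Lemma support_null (V : nat -> set X) : (forall m, open (V m)) ->
  (forall O x, open O -> O x -> exists2 m, V m x & V m `<=` O) ->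
  measurable (measure_support mu : set (borel X)) /\ mu (~` measure_support mu) = 0%E.
Proof.
move=> oV baseV; have mV m : measurable (V m : set (borel X)) by exact: sub_sigma_algebra.
pose W m : set (borel X) := if mu (V m) == 0%E then V m else set0.
have mW m : measurable (W m) by rewrite /W; case: ifP.
have suppE : ~` measure_support mu = \bigcup_m W m.
  apply/seteqP; split=> x /=.
    move=> /existsNP[S /not_implyP[oS /not_implyP[Sx nS]]].
    have [m Vx VS] := baseV S x oS Sx; exists m => //; rewrite /W ifT//.
    have mS : measurable (S : set (borel X)) by exact: sub_sigma_algebra.
    have VmS : (mu (V m) <= mu S)%E by apply: le_measure => //; apply/mem_set => //; exact: mV.
    by rewrite eq_le measure_ge0 andbT (le_trans VmS)// leNgt; exact/negP.
  move=> [m _]; rewrite /W; case: ifP => // /eqP V0 Vx h.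
  by have := h (V m) (oV m) Vx; rewrite V0 ltxx.
split.
  by rewrite -[measure_support mu]setCK suppE; apply/measurableC/bigcup_measurable.
rewrite suppE; apply/eqP; rewrite eq_le measure_ge0 andbT.
apply: le_trans (generalized_Boole_inequality mu mW _) _; first exact: bigcup_measurable.
rewrite le_eqVlt; apply/orP; left; apply/eqP/eseries0 => m _ _.
by rewrite /W; case: ifP => [/eqP//|_]; rewrite measure0.
Qed.

Hypothesis polishX : polish_space R X.

Lemma measurable_support :
  measurable (measure_support mu : set (borel X)) /\ mu (~` measure_support mu) = 0%E.
Proof.
have [sep [d [dm dt _]]] := polishX; have [q qd] := dense_enum dm dt sep.
by have [V [oV baseV]] := countable_base dm dt qd; exact: support_null oV baseV.
Qed.

Lemma support_equivalent (x : X) : measure_support mu x ->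
  exists nu : probability (borel X) R,
    forall A : set (borel X), measurable A -> nu A = 0%E <-> mu A = 0%E.
Proof.
move=> xsupp; apply: equivalent_probability.
by rewrite gt_eqF//; exact: xsupp openT _.
Qed.

Local Notation family := (self_indexed (ac_probabilities mu)).
Local Notation cost := (discrete_cost R (X := X)).

Lemma optimal_ratio_ge (m : nat) (x : 'I_m.+2 -> X) : injective x ->
  (forall k, measure_support mu (x k)) ->
  ((2 * (m.+2%:R - 1) / m.+2%:R)%:E <= optimal_ratio cost family)%E.
Proof.
move=> xinj xsupp; have [sep [d [dm dt dc]]] := polishX.
have [q qd] := dense_enum dm dt sep.
have [i [s [mi ms is_]]] := metric_retract dm dt dc qd.
have [nu munu] := support_equivalent (xsupp ord0).
have [W [oW Wx WW]] := disjoint_nbhs dm dt xinj.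
have mW k : measurable (W k : set (borel X)) by exact: sub_sigma_algebra.
have nuW k : nu (W k) != 0%E.
  apply/eqP => /(munu _ (mW k)) e; have := xsupp k _ (oW k) (Wx k).
  by rewrite e ltxx.
apply: le_ereal_inf_tmp => _ [Y Yc <-]; apply: le_ereal_inf_tmp => _ [r [r1 hr] <-].
rewrite lee_fin ler_pdivrMr// [leRHS]mulrC.
apply: (lower_bound mi ms is_ munu mW nuW WW Yc r1) => P Q.
by rewrite -(expected_costE mi is_); exact: hr.
Qed.

(** The bound [2 * (1 - 1 / m)] for [m] points of the support tends to 2. *)
Lemma optimal_ratio_ge2 :
  infinite_set (measure_support mu) -> (2%:E <= optimal_ratio cost family)%E.
Proof.
move=> /infiniteP/pcard_leP/injfunPex[/= x xf xi].
have xm m : injective (fun k : 'I_m.+2 => x k).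
  by move=> j k e; apply/val_inj/xi => //; exact: mem_set.
apply/lee_addgt0Pr => e e0; pose m := Num.truncn (2 / e).
apply: le_trans (leeD2r _ (optimal_ratio_ge (xm m) (fun k => xf k I))).
rewrite -EFinD lee_fin; have m0 : (0 : R) < m.+2%:R by [].
have me : 2 / m.+2%:R <= e.
  rewrite ler_pdivrMr// mulrC -ler_pdivrMr// ltW// (lt_trans (truncnS_gt _))//.
  by rewrite ltr_nat.
have -> : 2 * (m.+2%:R - 1) / m.+2%:R = 2 - 2 / m.+2%:R :> R.
  by field; rewrite gt_eqF.
by rewrite -addrA lerDl addrC subr_ge0.
Qed.

Lemma coupling_ratio_le2 : measure_support mu !=set0 ->
  exists Y : ac_probabilities mu -> {RV (@lebesgue01 R) >-> borel X},
    is_coupling family Y /\ (coupling_ratio cost family Y <= 2%:E)%E.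
Proof.
move=> [x xsupp]; have [sep [d [dm dt dc]]] := polishX.
have [q qd] := dense_enum dm dt sep.
have [i [s [mi ms is_]]] := metric_retract dm dt dc qd.
have [nu munu] := support_equivalent xsupp.
by have [Y Yr] := general_upper mi ms is_ munu; exists Y.
Qed.

(** A law that is absolutely continuous with respect to [mu] is carried by the
    support, since its complement is null. *)
Lemma coupling_ratio_le_finite (m : nat) (x : 'I_m.+2 -> X) :
  injective x -> range x = measure_support mu ->
  exists Y : ac_probabilities mu -> {RV (@lebesgue01 R) >-> borel X},
    is_coupling family Y /\
    (coupling_ratio cost family Y <= ((m.+2%:R + 1) / 3)%:E)%E.
Proof.
move=> xinj xran; have [sep [d [dm dt dc]]] := polishX.
have [q qd] := dense_enum dm dt sep.
have [i [s [mi _ is_]]] := metric_retract dm dt dc qd.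
have [msupp null] := measurable_support.
apply: (finite_upper mi is_ xinj isT) => P.
move=> /null_content_dominatesP/(_ _ (measurableC msupp) null) P0; rewrite xran.
have : P (measure_support mu `|` ~` measure_support mu) = 1%E.
  by rewrite setUv probability_setT.
rewrite measureU//; [|exact: measurableC|by rewrite setICr].
by move=> <-; rewrite -[LHS]adde0; congr (_ + _)%E.
Qed.

End support.

Local Open Scope ereal_scope.

Theorem theorem3 (R : realType) (X : ptopologicalType)
    (mu : {sigma_finite_measure set (borel X) -> \bar R})
    (polishX : polish_space R X)
    (n : \bar R) (n_card : n = counting (measure_support mu))
    (n_ge2 : 2%:E <= n) :
  let family := self_indexed (ac_probabilities mu) in
  let c := discrete_cost R (X := X) in
  let upper := Order.min 2%:E ((n + 1%:E) / 3%:E) in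
  [/\ 2%:E * (1%:E - 1%:E / n) <= optimal_ratio c family,
      optimal_ratio c family <= upper,
      exists Y : ac_probabilities mu -> {RV (@lebesgue01 R) >-> borel X},
        is_coupling family Y /\ coupling_ratio c family Y <= upper
    & n = +oo -> optimal_ratio c family = 2%:E].
Proof.
move=> family c upper.
have supp0 : measure_support mu !=set0.
  apply/set0P/eqP => s0; move: n_ge2; rewrite n_card s0 /counting.
  by rewrite asboolT// fset_set0 lee_fin ler_nat.
have [Y2 [Y2c Y2r]] := coupling_ratio_le2 polishX supp0.
have [fin|inf] := pselect (finite_set (measure_support mu)); last first.
  have noo : n = +oo by rewrite n_card /counting asboolF.
  have upper2 : upper = 2%:E.
    by rewrite /upper noo inver pnatr_eq0/= gt0_mulye ?lte_fin ?invr_gt0// min_l// leey.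
  have opt2 : optimal_ratio c family = 2%:E.
    apply/eqP; rewrite eq_le (optimal_ratio_ge2 polishX inf) andbT.
    apply: le_trans Y2r; apply: ge_ereal_inf.
    by exists (coupling_ratio c family Y2) => //; exists Y2.
  rewrite opt2 upper2; split=> //; last by exists Y2.
  by rewrite noo /inve mule0 sube0 mule1.
have [m [x [xinj xran cE]]] := finite_enum R fin.
rewrite cE in n_card; case: m x xinj xran n_card {cE} => [|[|m]] x xinj xran nE.
- by move: n_ge2; rewrite nE lee_fin ler_nat.
- by move: n_ge2; rewrite nE lee_fin ler_nat.
have [Y [Yc Yr]] : exists Y : ac_probabilities mu -> {RV (@lebesgue01 R) >-> borel X},
    is_coupling family Y /\ coupling_ratio c family Y <= upper.
  have [Y3 [Y3c Y3r]] := coupling_ratio_le_finite polishX xinj xran.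
  have upE : (n + 1%:E) / 3%:E = ((m.+2%:R + 1) / 3)%:E.
    by rewrite nE inver pnatr_eq0/= -EFinD -EFinM.
  have [le2|/ltW le3] := leP (2%:E : \bar R) (((m.+2%:R + 1) / 3)%:E).
    by exists Y2; split=> //; rewrite /upper upE le_min Y2r (le_trans Y2r).
  by exists Y3; split=> //; rewrite /upper upE le_min Y3r andbT (le_trans Y3r).
split=> //; last by rewrite nE.
- have -> : 2%:E * (1%:E - 1%:E / n) = (2 * (m.+2%:R - 1) / m.+2%:R)%:E.
    have -> : 1%:E / n = (m.+2%:R^-1)%:E by rewrite nE inver pnatr_eq0 mul1e.
    rewrite -EFinB -EFinM; congr EFin.
    by rewrite -mulrA mulrBl divff ?pnatr_eq0// mul1r.
  by apply: (optimal_ratio_ge polishX xinj) => k; rewrite -xran; exact: imageT.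
- apply: le_trans Yr; apply: ge_ereal_inf.
  by exists (coupling_ratio c family Y) => //; exists Y.
- by exists Y.
Qed.
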